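(* In the normal-cell setting described in the context, fix one piece $\alpha$ with $d:=d_\alpha\ge1$ and suppress the index $\alpha$. Fix $\boldsymbol\beta\in(0,\infty)^d$, put $Q:=\sum_i\beta_i$, let $c:P\to(0,\infty)$ be measurable with $0<c_-\le c(p)\le c_+<\infty$, and let $G:P\times\mathbb R^d\to[0,\infty)$ be measurable with $G(p,D_u^{\boldsymbol\beta}t)=uG(p,t)$ for all $p,t$ and $u>0$. Choose a scaled cell representation $(C(p),\Theta_q,j_q)$ of the scaled cells $\mathsf A_q(p)=D_{1/q}^{\boldsymbol\beta}(\mathsf A(p)\cap B_\varepsilon)$, $q>0$, and let $\widetilde{\mathcal D}_q$ be the associated transported density (all defined in the context). Let $R>0$ and assume that there are a finite set $\Lambda_R\subset[0,R]$ and measurable functions $\mathcal D_\lambda$ ($\lambda\in\Lambda_R$) on $\{(p,t):p\in P,\ t\in C(p)\}$ such that $$\sup_{p\in P}\int_{C(p)}|\mathcal D_\lambda(p,t)|e^{-G(p,t)}\,dt<\infty\qquad\text{for every }\lambda\in\Lambda_R,$$ and $$\sup_{p\in P}q^{-R}\int_{C(p)}\Bigl|\widetilde{\mathcal D}_q(p,t)-\sum_{\lambda\in\Lambda_R}q^\lambda\mathcal D_\lambda(p,t)\Bigr|e^{-G(p,t)}\,dt\longrightarrow0\qquad(q\downarrow0).$$ Set $\mathcal L_\lambda(p):=\int_{C(p)}\mathcal D_\lambda(p,t)e^{-G(p,t)}\,dt$. Then, as $z\to\infty$, uniformly in $p\in P$, $$\mathcal I(z,p)=e^{-zf_0}\sum_{\lambda\in\Lambda_R}z^{-(Q+\lambda)}c(p)^{-(Q+\lambda)}\mathcal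 L_\lambda(p)+o\bigl(e^{-zf_0}z^{-(Q+R)}\bigr).$$ If $P$ has finite volume, the same expansion holds after integration over $P$: $$\int_P\mathcal I(z,p)\,\mathrm{dvol}_P(p)=e^{-zf_0}\sum_{\lambda\in\Lambda_R}z^{-(Q+\lambda)}\int_Pc(p)^{-(Q+\lambda)}\mathcal L_\lambda(p)\,\mathrm{dvol}_P(p)+o\bigl(e^{-zf_0}z^{-(Q+R)}\bigr).$$
   Context: Setting. $(N,g)$ is a $C^2$ Riemannian manifold of dimension $n$ with Riemannian volume measure $\mathrm{dvol}_g$; $f:N\to\mathbb R$ is continuous and bounded below; $a:N\to\mathbb C$ is measurable; $f_0:=\inf_Nf$; $M:=\{x\in N:f(x)=f_0\}$ is nonempty and compact. $\mathcal T_\varepsilon(M):=\{x:\operatorname{dist}_g(x,M)<\varepsilon\}$; $B_r$ is the open Euclidean ball of radius $r$ at $0$. $M=\bigsqcup_{j=0}^{\ell}\Sigma_j$ is a disjoint union of finitely many $C^2$ embedded strata, $\Sigma_j$ a (possibly empty or disconnected) $j$-dimensional submanifold. Normal-cell decomposition. There are $\varepsilon>0$ and a finite index set $\mathcal A$, and for each $\alpha\in\mathcal A$: a Borel set $P_\alpha\subset\Sigma_{j_\alpha}$ of finite $j_\alpha$-dimensional Riemannian volume, with $M=\bigsqcup_\alpha P_\alpha$; an open neighborhood $U_\alpha$ of $P_\alpha$ in $\Sigma_{j_\alpha}$; $d_\alpha:=n-j_\alpha$; a $C^1$ map $F_\alpha:U_\alpha\times B_\varepsilon\to N$ with $F_\alpha(p,0)=p$;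 and sets (cells) $\mathsf A_\alpha(p)\subset\mathbb R^{d_\alpha}$, $p\in P_\alpha$, with measurable graph. With $\mathfrak D_\alpha(\varepsilon):=\{(p,s):p\in P_\alpha,\ s\in\mathsf A_\alpha(p)\cap B_\varepsilon\}$, the sets $F_\alpha(\mathfrak D_\alpha(\varepsilon))$ are pairwise disjoint up to null sets and cover $\mathcal T_\varepsilon(M)$ up to a null set, and there are measurable $J_\alpha:\mathfrak D_\alpha(\varepsilon)\to(0,\infty)$ such that for every nonnegative measurable $h$ $$\int_{F_\alpha(\mathfrak D_\alpha(\varepsilon))}h\,\mathrm{dvol}_g=\int_{P_\alpha}\int_{\mathsf A_\alpha(p)\cap B_\varepsilon}h(F_\alpha(p,s))J_\alpha(p,s)\,ds\,\mathrm{dvol}_{P_\alpha}(p).$$ For $z>0$ put $\mathcal I_\alpha(z,p):=\int_{\mathsf A_\alpha(p)\cap B_\varepsilon}a(F_\alpha(p,s))J_\alpha(p,s)e^{-zf(F_\alpha(p,s))}\,ds$. Dilations. $D_u^{\boldsymbol\beta}t:=(u^{\beta_1}t_1,\dots,u^{\beta_d}t_d)$ for $u>0$. Scaled quantities (index suppressed). $b(p,s):=a(F(p,s))J(p,s)$, $\phi(p,s):=(f(F(p,s))-f_0)/c(p)$ and, for $q>0$, $\mathsf A_q(p):=D_{1/q}^{\boldsymbol\beta}(\mathsf A(p)\cap B_\varepsilon)$. Scaled cell representation. It consists of sets (reference cells) $C(p)\subset\mathbb R^d$ with measurable graph in $P\times\mathbb R^d$, and families $\Theta_q(p,t)\in\mathbb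 R^d$, $j_q(p,t)\ge0$, jointly measurable in $(q,p,t)$ on that graph, such that for every nonnegative measurable $\psi$, $$\int_{\mathsf A_q(p)}\psi(u)\,du=\int_{C(p)}\psi(\Theta_q(p,t))\,j_q(p,t)\,dt .$$ No injectivity or smoothness is required; on $\{j_q>0\}$ the map $\Theta_q(p,\cdot)$ takes values in $\mathsf A_q(p)$. Transported density. On $\{j_q>0\}$ put $\widetilde b_q(p,t):=b(p,D_q^{\boldsymbol\beta}\Theta_q(p,t))\,j_q(p,t)$ and $\Phi_q(p,t):=q^{-1}\phi(p,D_q^{\boldsymbol\beta}\Theta_q(p,t))$; on $\{j_q=0\}$ put $\widetilde b_q=0$, $\Phi_q=G$. Then $\widetilde{\mathcal D}_q(p,t):=\widetilde b_q(p,t)\,e^{G(p,t)-\Phi_q(p,t)}$. *)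

(* Defs.v *)
From HB Require Import structures.
From mathcomp Require Import all_boot all_order all_algebra finmap.
From mathcomp Require Import complex.
From mathcomp Require Import all_classical all_reals all_analysis.
From mathcomp Require Import measurable_realfun.
Set Implicit Arguments.
Unset Strict Implicit.
Unset Printing Implicit Defensive.
Import Order.TTheory GRing.Theory Num.Theory.
Import numFieldNormedType.Exports.
Local Open Scope classical_set_scope.
Local Open Scope complex_scope.
Local Open Scope ring_scope.

(* "Measurable" always means Borel measurable on topological spaces. *)
Definition borel (T : ptopologicalType) := g_sigma_algebraType (@open T).

Section rV_measurability.
Context {R : realType}.

Lemma borel_open (T : ptopologicalType) (A : set T) :
  open A -> measurable (A : set (borel T)).
Proof. by move=> oA; apply: sub_sigma_algebra. Qed.

Lemma measurable_coord d (j : 'I_d) :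
  measurable_fun [set: borel 'rV[R]_d] (fun x => x ord0 j : R).
Proof.
apply: (measurability _ (RGenOpens.measurableE R)) => _ [_ [a [b ->]] <-].
rewrite setTI; apply: borel_open.
apply: (open_comp (f := fun M : 'rV[R]_d => M ord0 j)).
  by move=> x _; exact: coord_continuous.
exact: interval_open.
Qed.

Lemma measurable_rV {dT} {T : measurableType dT} d (D : set T)
    (g : T -> borel 'rV[R]_d) :
  (forall j, measurable_fun D (fun x => g x ord0 j : R)) -> measurable_fun D g.
Proof.
move=> mg mD.
suff mgD : measurable_fun D g by exact: mgD.
have E : @measurable _ (borel 'rV[R]_d) = <<s @open 'rV[R]_d >> by [].
apply: (@measurability _ _ T (borel 'rV[R]_d) D g _ E).
move=> _ [V oV <-].
pose box (k : 'rV[rat]_d * rat) : set 'rV[R]_d :=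
  [set y | forall j, `|ratr (k.1 ord0 j) - y ord0 j| < ratr k.2].
have -> : V = \bigcup_(k in [set k | box k `<=` V]) box k.
  apply/seteqP; split=> [x Vx|x [k kV kx]]; last exact: kV.
  have /nbhs_ballP[e /= e0 eV] : nbhs x V by exact: open_nbhs_nbhs.
  have /rat_in_itvoo[r /itvP re] : 0 < e / 2 by rewrite divr_gt0.
  have r0 : 0 < ratr r :> R by rewrite re.
  have /choice[q qP] : forall j, exists q : rat, `|ratr q - x ord0 j| < ratr r.
    move=> j; have /rat_in_itvoo[q /itvP qP] : x ord0 j < x ord0 j + ratr r.
      by rewrite ltrDl.
    by exists q; rewrite gtr0_norm ?subr_gt0 ?qP// ltrBlDl qP.
  exists (\row_j q j, r) => [y /= yB|j /=]; last by rewrite mxE.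
  apply: eV; split => // i j; rewrite !ord1 /ball/=.
  have := yB j; rewrite mxE => yj.
  rewrite -(subrK (ratr (q j)) (x ord0 j)) -addrA.
  apply: le_lt_trans (ler_normD _ _) _.
  rewrite [ltRHS](splitr e) distrC ltrD//.
    by rewrite (lt_trans (qP j))// re.
  by rewrite (lt_trans yj)// re.
rewrite preimage_bigcup setI_bigcupr bigcup_mkcond.
have cK : countable [set: (matrix rat 1 d * rat)%type] by exact: countableP.
apply: (countable_bigcupT_measurable cK) => k.
case: ifPn => // _.
have -> : D `&` g @^-1` box k = D `&` \bigcap_(j in [set: 'I_d])
    (D `&` [set x | `|ratr (k.1 ord0 j) - g x ord0 j| < ratr k.2]).
  apply/seteqP; split=> x [Dx /= H]; split=> // j; last by have [] := H j I.
  by move=> _; split => //; exact: H.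
apply: measurableI => //; apply: fin_bigcap_measurable => // j _.
have := mg j mD _ (measurable_itv
  `](ratr (k.1 ord0 j) - ratr k.2), (ratr (k.1 ord0 j) + ratr k.2)[).
congr measurable; apply/seteqP; split => x/= [Dx];
  rewrite in_itv/= => H; split => //.
  by rewrite distrC ltr_distl.
by move: H; rewrite distrC ltr_distl.
Qed.

End rV_measurability.

(* Lebesgue measure on R^d, by iterating the product with lebesgue_measure. *)
Section lebesgue.
Context {R : realType}.

Definition consrV d (x : R * borel 'rV[R]_d) : borel 'rV[R]_d.+1 :=
  row_mx (\row_(_ < 1) x.1) x.2.

Lemma measurable_consrV d : measurable_fun setT (@consrV d).
Proof.
apply: measurable_rV => j.
rewrite -[d.+1]/(1 + d)%N in j *.
rewrite /consrV; case: (fintype.split_ordP j) => i ->.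
  apply: eq_measurable_fun measurable_fst => x _ /=.
  by rewrite row_mxEl mxE.
apply: eq_measurable_fun
  (measurableT_comp (measurable_coord i) measurable_snd) => x _ /=.
by rewrite row_mxEr.
Qed.

Definition unconsrV d (x : borel 'rV[R]_d.+1) : R * borel 'rV[R]_d :=
  (x ord0 ord0, rsubmx (x : 'rV_(1 + d))).

Lemma measurable_unconsrV d : measurable_fun setT (@unconsrV d).
Proof.
apply: measurable_fun_pair; first exact: measurable_coord.
apply: measurable_rV => j.
apply: eq_measurable_fun (measurable_coord (rshift 1 j)) => x _ /=.
by rewrite mxE.
Qed.

Lemma consrVK d : cancel (@consrV d) (@unconsrV d).
Proof.
move=> [x y]; rewrite /unconsrV /consrV/= row_mxKr; congr (_, _).
have -> : ord0 = lshift d (ord0 : 'I_1) :> 'I_(1 + d) by exact: val_inj.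
by apply: (etrans (row_mxEl _ _ _ _)); rewrite mxE.
Qed.

Section step.
Variables (d : nat) (m : {sigma_finite_measure set (borel 'rV[R]_d) -> \bar R}).

Definition lebesgue_step :=
  pushforward (@lebesgue_measure R \x m)%E (@consrV d).

Let step0 : lebesgue_step set0 = 0%E.
Proof. by rewrite /lebesgue_step /pushforward preimage_set0 measure0. Qed.

Let step_ge0 A : (0 <= lebesgue_step A)%E.
Proof. by rewrite /lebesgue_step /pushforward; apply: integral_ge0. Qed.

Let step_sigma_additive : semi_sigma_additive lebesgue_step.
Proof.
move=> F mF tF mUF; rewrite /lebesgue_step /pushforward preimage_bigcup.
apply: measure_semi_sigma_additive.
- by move=> n; rewrite -[X in measurable X]setTI; exact: measurable_consrV.
- apply/trivIsetP => /= i j _ _ ij; rewrite -preimage_setI.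
  by move/trivIsetP : tF => /(_ _ _ _ _ ij) ->//; rewrite preimage_set0.
- by rewrite -preimage_bigcup -[X in measurable X]setTI;
    exact: measurable_consrV.
Qed.

HB.instance Definition _ :=
  isMeasure.Build _ _ _ lebesgue_step step0 step_ge0 step_sigma_additive.

Let sigma_finite_step : sigma_finite setT lebesgue_step.
Proof.
have /sigma_finiteP[F [TF ndF Foo]] := sigma_finiteT (@lebesgue_measure R).
have /sigma_finiteP[H [TH ndH Hoo]] := sigma_finiteT m.
exists (fun n => @unconsrV d @^-1` (F n `*` H n)).
  rewrite -preimage_bigcup; apply/seteqP; split=> // x _.
  have [n _ Fn] : (\bigcup_n F n) (unconsrV x).1 by rewrite -TF.
  have [k _ Hk] : (\bigcup_n H n) (unconsrV x).2 by rewrite -TH.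
  exists (maxn n k) => //; split.
    by move: Fn; exact/subsetPset/ndF/leq_maxl.
  by move: Hk; exact/subsetPset/ndH/leq_maxr.
move=> n; have [mF Fn] := Foo n; have [mH Hn] := Hoo n; split.
  rewrite -[X in measurable X]setTI; apply: measurable_unconsrV => //.
  exact: measurableX.
rewrite /lebesgue_step /pushforward -comp_preimage.
rewrite (_ : _ \o _ = id); last by apply/funext => x; exact: consrVK.
rewrite preimage_id; apply: le_lt_trans (_ : (_ * _ < +oo)%E).
  by rewrite product_measure1E.
by rewrite lte_mul_pinfty// ge0_fin_numE.
Qed.

HB.instance Definition _ :=
  Measure_isSigmaFinite.Build _ _ _ lebesgue_step sigma_finite_step.
End step.

Fixpoint lebesgue_rV d : {sigma_finite_measure set (borel 'rV[R]_d) -> \bar R} :=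
  match d with
  | 0 => \d_(0 : borel 'rV[R]_0)
  | d'.+1 => lebesgue_step (lebesgue_rV d')
  end.
End lebesgue.

(* Complex-valued functions are measurable, integrable and integrated through
   their real and imaginary parts. *)
Section complex_integral.
Context {R : realType} {dT : measure_display} {T : measurableType dT}.

Definition cmeasurable (D : set T) (h : T -> R[i]) :=
  measurable_fun D (fun x => complex.Re (h x)) /\
  measurable_fun D (fun x => complex.Im (h x)).

Definition cintegrable (mu : {measure set T -> \bar R}) (D : set T)
    (h : T -> R[i]) :=
  mu.-integrable D (fun x => (complex.Re (h x))%:E) /\
  mu.-integrable D (fun x => (complex.Im (h x))%:E).

Definition cintegral (mu : {measure set T -> \bar R}) (D : set T)
    (h : T -> R[i]) : R[i] :=
  (\int[mu]_(x in D) complex.Re (h x)) +i* (\int[mu]_(x in D) complex.Im (h x)).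

End complex_integral.

Definition cabs {R : realType} (w : R[i]) : R := ComplexField.Normc.normc w.

(* Supremum of a [0, +oo]-valued function; it is 0, not -oo, on set0. *)
Definition usup {R : realType} {T : Type} (D : set T) (h : T -> \bar R) :
  \bar R := ereal_sup (0%E |` [set h x | x in D]).

Section euclidean.
Context {R : realType} {d : nat}.

Definition enorm (x : 'rV[R]_d) : R := Num.sqrt (\sum_i x ord0 i ^+ 2).

(* The norm of the library on 'rV[R]_d is the sup norm, hence this ball. *)
Definition eball (r : R) : set 'rV[R]_d := [set x | enorm x < r].

Definition dilation (beta : 'I_d -> R) (u : R) (t : 'rV[R]_d) : 'rV[R]_d :=
  \row_i (u `^ beta i * t ord0 i).

End euclidean.

(* To be used on an open set U. *)
Fixpoint Ck {R : realType} {V W : normedModType R} (k : nat) (U : set V)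
    (f : V -> W) : Prop :=
  match k with
  | 0 => forall x, U x -> {for x, continuous f}
  | k'.+1 => (forall x, U x -> differentiable f x) /\
             forall v, Ck k' U ('D_v f)
  end.

Section riemannian_manifolds.
Context {R : realType}.

Record chart (N : ptopologicalType) (n : nat) := Chart {
  cdom : set N;
  cimg : set 'rV[R]_n;
  cmap : N -> 'rV[R]_n;
  cinv : 'rV[R]_n -> N }.

Definition is_chart (N : ptopologicalType) n (c : chart N n) :=
  [/\ open (cdom c) /\ open (cimg c),
      forall x, cdom c x -> cimg c (cmap c x) /\ cinv c (cmap c x) = x,
      forall y, cimg c y -> cdom c (cinv c y) /\ cmap c (cinv c y) = y,
      forall x, cdom c x -> {for x, continuous (cmap c)} &
      forall y, cimg c y -> {for y, continuous (cinv c)}].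

Definition transition (N : ptopologicalType) n (c c' : chart N n) :
  'rV[R]_n -> 'rV[R]_n := cmap c' \o cinv c.

Definition overlap (N : ptopologicalType) n (c c' : chart N n) :
  set 'rV[R]_n := cimg c `&` cinv c @^-1` cdom c'.

Definition C2_compatible (N : ptopologicalType) n (c c' : chart N n) :=
  Ck 2 (overlap c c') (transition c c') /\
  Ck 2 (overlap c' c) (transition c' c).

(* A C^2 manifold, given by its maximal atlas, with a Riemannian metric: in
   C^2 charts the components of a metric can be at best of class C^1.
   Tangent vectors are row vectors: in the chart c, the inner product of
   v and w at the point of coordinates y is v *m metric c y *m w^T. *)
Record riemannian_manifold (N : ptopologicalType) (n : nat) := {
  atlas : set (chart N n);
  metric : chart N n -> 'rV[R]_n -> 'M[R]_n;
  rm_hausdorff : hausdorff_space N;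
  rm_second_countable : @second_countable N;
  rm_cover : forall x, exists2 c, atlas c & cdom c x;
  rm_chart : forall c, atlas c -> is_chart c;
  rm_compatible : forall c c', atlas c -> atlas c' -> C2_compatible c c';
  rm_maximal : forall c, is_chart c ->
    (forall c', atlas c' -> C2_compatible c c') -> atlas c;
  rm_metric_C1 : forall c, atlas c -> Ck 1 (cimg c) (metric c);
  rm_metric_sym : forall c y, atlas c -> cimg c y ->
    (metric c y)^T = metric c y;
  rm_metric_pos : forall c y (v : 'rV[R]_n), atlas c -> cimg c y -> v != 0 ->
    0 < (v *m metric c y *m v^T) ord0 ord0;
  rm_metric_change : forall c c' y, atlas c -> atlas c' -> overlap c c' y ->
    metric c y = 'J (transition c c') y *m metric c' (transition c c' y)
                   *m ('J (transition c c') y)^T }.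

Section metric_notions.
Context {N : ptopologicalType} {n : nat} (X : riemannian_manifold N n).

(* Appends n - j zero coordinates. *)
Definition slice_incl j (y : 'rV[R]_j) : 'rV[R]_n := y *m pid_mx j.

Definition adapted_chart j (S : set N) (c : chart N n) :=
  atlas X c /\
  forall x, cdom c x -> (S x <-> exists y : 'rV[R]_j, cmap c x = slice_incl y).

Definition C2_submanifold j (S : set N) :=
  forall p, S p -> (j <= n)%N /\ exists2 c, adapted_chart j S c & cdom c p.

Definition induced_metric j (c : chart N n) (y : 'rV[R]_j) : 'M[R]_j :=
  pid_mx j *m metric X c (slice_incl y) *m (pid_mx j)^T.

(* sigma is the j-dimensional Riemannian volume of the submanifold S, as a
   measure on N carried by S; for S = setT and j = n it is dvol_g. *)
Definition riemannian_volume j (S : set N)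
    (sigma : {measure set (borel N) -> \bar R}) :=
  (forall A : set N, measurable (A : set (borel N)) -> A `&` S = set0 ->
    sigma A = 0%E) /\
  forall c (A : set N), adapted_chart j S c ->
    measurable (A : set (borel N)) -> A `<=` cdom c ->
    sigma A = (\int[lebesgue_rV j]_(y in
        [set y : 'rV[R]_j | cimg c (slice_incl y) /\
                             A (cinv c (slice_incl y))])
      (Num.sqrt (\det (induced_metric c y)))%:E)%E.

Definition arc_length (c : chart N n) (u : R -> 'rV[R]_n) : \bar R :=
  (\int[lebesgue_measure]_(t in `[0%R, 1%R])
    (Num.sqrt ((derive1 u t *m metric X c (u t) *m (derive1 u t)^T) ord0 ord0))%:E)%E.

(* A piecewise C^1 path is a concatenation of C^1 arcs, each of them
   contained in the domain of a chart. *)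
Inductive path_length : N -> N -> \bar R -> Prop :=
| path_nil x : path_length x x 0%E
| path_cons c (u : R -> 'rV[R]_n) y L :
    atlas X c -> Ck 1 [set: R^o] (u : R^o -> 'rV[R]_n) ->
    (forall t, 0 <= t <= 1 -> cimg c (u t)) ->
    path_length (cinv c (u 1)) y L ->
    path_length (cinv c (u 0)) y (arc_length c u + L)%E.

Definition rdist (x y : N) : \bar R := ereal_inf (path_length x y).

Definition tube (M : set N) (eps : R) : set N :=
  [set x | (ereal_inf [set rdist x m | m in M] < eps%:E)%E].

(* F is C^1 on U x B_eps, for U open in the j-dimensional submanifold S; the
   product is read in adapted charts of S, as an open subset of R^(j + d). *)
Definition C1_normal_map j d (S U : set N) (eps : R)
    (F : N -> 'rV[R]_d -> N) :=
  {within U `*` eball eps, continuous (fun ps => F ps.1 ps.2)} /\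
  forall c c', adapted_chart j S c -> atlas X c' ->
    let G (w : 'rV[R]_(j + d)) :=
      F (cinv c (slice_incl (lsubmx w))) (rsubmx w) in
    Ck 1 [set w | [/\ cimg c (slice_incl (lsubmx w)),
                      U (cinv c (slice_incl (lsubmx w))),
                      eball eps (rsubmx w) & cdom c' (G w)]]
         (cmap c' \o G).

End metric_notions.

(* Piece a lies in the stratum of index sdim a; maps and cells indexed by
   p : N are only relevant for p in nbhd a, resp. piece a. *)
Record cell_data (N : ptopologicalType) (n l : nat) (I : finType) := {
  sdim : I -> 'I_l.+1;
  codim := fun a => (n - sdim a)%N;
  piece : I -> set N;
  nbhd : I -> set N;
  nmap : forall a, N -> 'rV[R]_(codim a) -> N;
  cell : forall a, N -> set 'rV[R]_(codim a);
  jac : forall a, N -> 'rV[R]_(codim a) -> R }.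

Arguments nmap {N n l I} c a p s.
Arguments cell {N n l I} c a p.
Arguments jac {N n l I} c a p s.

Definition graph {N : ptopologicalType} {d} (P : set N)
    (A : N -> set 'rV[R]_d) : set (borel N * borel 'rV[R]_d) :=
  [set ps | P ps.1 /\ A ps.1 ps.2].

Definition cut_cell {N : ptopologicalType} {d} (A : N -> set 'rV[R]_d)
  (eps : R) (p : N) : set 'rV[R]_d := A p `&` eball eps.

(* The sets nc_image a need not be Borel; they are analytic, and the integral
   over them, a supremum over simple functions, is that of the completion. *)
Record normal_cell_decomposition (N : ptopologicalType) (n l : nat)
    (I : finType) (X : riemannian_manifold N n) (M : set N)
    (S : 'I_l.+1 -> set N)
    (dvol : {measure set (borel N) -> \bar R})
    (svol : 'I_l.+1 -> {measure set (borel N) -> \bar R})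
    (eps : R) (K : cell_data N n l I) : Prop := {
  nc_eps : 0 < eps;
  nc_piece_Borel : forall a, measurable (piece K a : set (borel N));
  nc_piece_sub : forall a, piece K a `<=` S (sdim K a);
  nc_piece_fin : forall a, (svol (sdim K a) (piece K a) < +oo)%E;
  nc_piece_cover : M = \bigcup_a piece K a;
  nc_piece_disj : trivIset setT (piece K);
  nc_nbhd : forall a, piece K a `<=` nbhd K a /\
    exists2 V, open V & nbhd K a = S (sdim K a) `&` V;
  nc_nmap_C1 : forall a,
    C1_normal_map X (sdim K a) (S (sdim K a)) (nbhd K a) eps (nmap K a);
  nc_nmap0 : forall a p, nbhd K a p -> nmap K a p 0 = p;
  nc_cell_graph : forall a, measurable (graph (piece K a) (cell K a));
  nc_jac_pos : forall a p s, piece K a p ->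
    cut_cell (cell K a) eps p s -> 0 < jac K a p s;
  nc_jac_meas : forall a,
    measurable_fun (graph (piece K a) (cut_cell (cell K a) eps))
      (fun ps => jac K a ps.1 ps.2);
  nc_image := fun a => [set nmap K a ps.1 ps.2 |
      ps in graph (piece K a) (cut_cell (cell K a) eps)];
  nc_image_disj : forall a b, a != b ->
    dvol.-negligible (nc_image a `&` nc_image b : set (borel N));
  nc_image_cover :
    dvol.-negligible (tube X M eps `\` \bigcup_a nc_image a : set (borel N));
  nc_change : forall a (h : borel N -> \bar R),
    measurable_fun setT h -> (forall x, 0 <= h x)%E ->
    (\int[dvol]_(x in nc_image a) h x =
     \int[svol (sdim K a)]_(p in piece K a)
       \int[lebesgue_rV (codim K a)]_(s in cut_cell (cell K a) eps p)
         (h (nmap K a p s) * (jac K a p s)%:E))%E }.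

End riemannian_manifolds.

Arguments nmap {R N n l I} c a p s.
Arguments cell {R N n l I} c a p.
Arguments jac {R N n l I} c a p s.

Section scaled_cells.
Context {R : realType} {N : ptopologicalType} {d : nat}.
Implicit Types (P : set N) (A C : N -> set 'rV[R]_d) (p : N) (q : R).

Definition scaled_cell (beta : 'I_d -> R) A (eps : R) q p : set 'rV[R]_d :=
  dilation beta q^-1 @` cut_cell A eps p.

(* Theta q p t and jq q p t are only relevant for q > 0, p in P, t in C p. *)
Record scaled_cell_representation P (Aq : R -> N -> set 'rV[R]_d) C
    (Theta : R -> N -> 'rV[R]_d -> 'rV[R]_d)
    (jq : R -> N -> 'rV[R]_d -> R) : Prop := {
  sc_graph : measurable (graph P C);
  sc_Theta_meas : measurable_fun
    ([set q : R | 0 < q] `*` graph P C :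
       set (R * (borel N * borel 'rV[R]_d)))
    (fun x => Theta x.1 x.2.1 x.2.2 : borel 'rV[R]_d);
  sc_jq_meas : measurable_fun
    ([set q : R | 0 < q] `*` graph P C :
       set (R * (borel N * borel 'rV[R]_d)))
    (fun x => jq x.1 x.2.1 x.2.2);
  sc_jq_ge0 : forall q p t, 0 < q -> P p -> C p t -> 0 <= jq q p t;
  sc_change : forall q p (psi : borel 'rV[R]_d -> \bar R), 0 < q -> P p ->
    measurable_fun setT psi -> (forall u, 0 <= psi u)%E ->
    (\int[lebesgue_rV d]_(u in Aq q p) psi u =
     \int[lebesgue_rV d]_(t in C p) (psi (Theta q p t) * (jq q p t)%:E))%E;
  sc_values : forall q p t, 0 < q -> P p -> C p t ->
    0 < jq q p t -> Aq q p (Theta q p t) }.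

Definition cell_integrand (f : N -> R) (a : N -> R[i])
    (F : N -> 'rV[R]_d -> N) (J : N -> 'rV[R]_d -> R) (z : R) (p : N)
    (s : 'rV[R]_d) : R[i] :=
  a (F p s) * (J p s * expR (- z * f (F p s)))%:C.

Definition cell_integral f a F J A (eps z : R) (p : N) : R[i] :=
  cintegral (lebesgue_rV d) (cut_cell A eps p : set (borel 'rV[R]_d))
    (cell_integrand f a F J z p).

Definition amplitude (a : N -> R[i]) (F : N -> 'rV[R]_d -> N)
    (J : N -> 'rV[R]_d -> R) (p : N) (s : 'rV[R]_d) : R[i] :=
  a (F p s) * (J p s)%:C.

Definition phase (f : N -> R) (f0 : R) (F : N -> 'rV[R]_d -> N) (c : N -> R)
    (p : N) (s : 'rV[R]_d) : R := (f (F p s) - f0) / c p.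

Definition transported_amplitude beta
    (Theta : R -> N -> 'rV[R]_d -> 'rV[R]_d) (jq : R -> N -> 'rV[R]_d -> R)
    (b : N -> 'rV[R]_d -> R[i]) q p t : R[i] :=
  if 0 < jq q p t
  then b p (dilation beta q (Theta q p t)) * (jq q p t)%:C else 0.

Definition transported_phase beta
    (Theta : R -> N -> 'rV[R]_d -> 'rV[R]_d) (jq : R -> N -> 'rV[R]_d -> R)
    (phi G : N -> 'rV[R]_d -> R) q p t : R :=
  if 0 < jq q p t
  then q^-1 * phi p (dilation beta q (Theta q p t)) else G p t.

Definition transported_density beta
    (Theta : R -> N -> 'rV[R]_d -> 'rV[R]_d) (jq : R -> N -> 'rV[R]_d -> R)
    (b : N -> 'rV[R]_d -> R[i]) (phi G : N -> 'rV[R]_d -> R) q p t : R[i] :=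
  transported_amplitude beta Theta jq b q p t *
  (expR (G p t - transported_phase beta Theta jq phi G q p t))%:C.

End scaled_cells.

(* Main.v *)
Require Import Defs.
From HB Require Import structures.
From mathcomp Require Import all_boot all_order all_algebra finmap.
From mathcomp Require Import complex.
From mathcomp Require Import all_classical all_reals all_analysis.
From mathcomp Require Import measurable_realfun ring.
Set Implicit Arguments.
Unset Strict Implicit.
Unset Printing Implicit Defensive.
Import Order.TTheory GRing.Theory Num.Theory.
Import numFieldNormedType.Exports.
Local Open Scope classical_set_scope.
Local Open Scope complex_scope.
Local Open Scope ring_scope.

(* Put q = 1 / (z c(p)).  The dilation s = D_q u followed by the scaled cell
   representation turns I(z, p) into
     e^(- z f0) q^Q \int_(C(p)) D_q~(p, t) e^(- G(p, t)) dt,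
   because z f = z f0 + q^-1 phi and the Jacobian of D_q is q^Q.  The assumed
   expansion of D_q~ can then be integrated term by term, and
   q^x = z^(-x) c(p)^(-x); the error is uniform in p since q <= 1 / (z cmin).
   Integration over P only needs p |-> I(z, p) to be measurable and P to have
   finite volume. *)

(** * Complex-valued integrals *)

Section complex_integral_theory.
Context {R : realType} {dT : measure_display} {T : measurableType dT}.
Implicit Types (h : T -> R[i]) (r : T -> R) (D : set T).

(** The obstacle is how little is known on either side of the substitution. The representation
    changes variables for nonnegative functions only, [Theta] may leave the scaled cell where [jq]
    vanishes, and the integrand is known to be measurable only on the graph of the cut cells. So
    functions on a cell are extended by zero, and a complex integrand passes through its real and
    imaginary parts, then through their positive and negative parts. Integrability of the cell
    integrand is not given either; it flows backwards. The error of the expansion and the weighted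
    [D la] have finite integrals for small q, so the transported density times e^(- G) is integrable
    on the reference cell, and the change of variables for absolute values returns this to the cut
    cell. Over [P] the same pattern recurs: bounded remainder plus integrable coefficients. Joint
    measurability in (p, s) refers to the product of two Borel sigma-algebras; second countability
    of the manifold is what brings the open sets of the product topology, hence the continuity of
    [F], into it. *)

Lemma ReD (x y : R[i]) : complex.Re (x + y) = complex.Re x + complex.Re y.
Proof. by case: x y => [? ?] [? ?]. Qed.

Lemma ImD (x y : R[i]) : complex.Im (x + y) = complex.Im x + complex.Im y.
Proof. by case: x y => [? ?] [? ?]. Qed.

Lemma Re_mulrl (k : R) (x : R[i]) : complex.Re (k%:C * x) = k * complex.Re x.
Proof. by case: x => u v /=; rewrite mul0r subr0. Qed.

Lemma Im_mulrl (k : R) (x : R[i]) : complex.Im (k%:C * x) = k * complex.Im x.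
Proof. by case: x => u v /=; rewrite mul0r addr0. Qed.

Lemma complex_eqP (x y : R[i]) :
  complex.Re x = complex.Re y -> complex.Im x = complex.Im y -> x = y.
Proof. by case: x y => [? ?] [? ?] /= -> ->. Qed.

Lemma cabsE (x : R[i]) :
  cabs x = Num.sqrt (complex.Re x ^+ 2 + complex.Im x ^+ 2).
Proof. by case: x. Qed.

Lemma cabs_ge0 (x : R[i]) : 0 <= cabs x.
Proof. by rewrite cabsE sqrtr_ge0. Qed.

Lemma cabsM (x y : R[i]) : cabs (x * y) = cabs x * cabs y.
Proof. exact: ComplexField.Normc.normcM. Qed.

Lemma cabs_real (k : R) : cabs k%:C = `|k|.
Proof. by rewrite cabsE/= expr0n addr0 sqrtr_sqr. Qed.

Lemma normr_Re_le (x : R[i]) : `|complex.Re x| <= cabs x.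
Proof. by rewrite cabsE -sqrtr_sqr ler_wsqrtr// lerDl sqr_ge0. Qed.

Lemma normr_Im_le (x : R[i]) : `|complex.Im x| <= cabs x.
Proof. by rewrite cabsE -sqrtr_sqr ler_wsqrtr// lerDr sqr_ge0. Qed.

Lemma cabs_le (x : R[i]) : cabs x <= `|complex.Re x| + `|complex.Im x|.
Proof.
rewrite cabsE -[leRHS]ger0_norm ?addr_ge0// -sqrtr_sqr ler_wsqrtr//.
rewrite sqrrD !real_normK ?num_real// -addrA lerD2l lerDr.
by rewrite mulrn_wge0// mulr_ge0.
Qed.

Lemma eq_cmeasurable D h h' : (forall x, D x -> h x = h' x) ->
  cmeasurable D h -> cmeasurable D h'.
Proof.
move=> hh' [mRe mIm]; split.
- by apply: eq_measurable_fun mRe => x /set_mem Dx; rewrite hh'.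
- by apply: eq_measurable_fun mIm => x /set_mem Dx; rewrite hh'.
Qed.

Lemma cmeasurableD D h h' : cmeasurable D h -> cmeasurable D h' ->
  cmeasurable D (fun x => h x + h' x).
Proof.
move=> [? ?] [? ?]; split.
- by under eq_fun do rewrite ReD; exact: measurable_funD.
- by under eq_fun do rewrite ImD; exact: measurable_funD.
Qed.

Lemma cmeasurable_mulrl D r h : measurable_fun D r -> cmeasurable D h ->
  cmeasurable D (fun x => (r x)%:C * h x).
Proof.
move=> ? [? ?]; split.
- by under eq_fun do rewrite Re_mulrl; exact: measurable_funM.
- by under eq_fun do rewrite Im_mulrl; exact: measurable_funM.
Qed.

Lemma measurable_cabs D h : cmeasurable D h -> measurable_fun D (cabs \o h).
Proof.
move=> [? ?]; rewrite (_ : cabs \o h = fun x => Num.sqrt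
  (complex.Re (h x) ^+ 2 + complex.Im (h x) ^+ 2)); last first.
  by apply/funext => x /=; rewrite cabsE.
apply: (measurableT_comp (f := Num.sqrt : R -> R));
  first exact: continuous_measurable_fun (@sqrt_continuous R).
by apply: measurable_funD; exact: measurable_funX.
Qed.

Section integrals.
Variables (mu : {measure set T -> \bar R}) (D : set T).
Hypothesis mD : measurable D.

Lemma cintegrableP h : cmeasurable D h ->
  (\int[mu]_(x in D) (cabs (h x))%:E < +oo)%E -> cintegrable mu D h.
Proof.
move=> mh hoo.
have icabs : mu.-integrable D (EFin \o (cabs \o h)).
  apply/integrableP; split; first exact/measurable_EFinP/measurable_cabs.
  by under eq_integral do rewrite /= ger0_norm ?cabs_ge0//.
split; apply: le_integrable icabs => //.
- by apply/measurable_EFinP; case: mh.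
- by move=> x _ /=; rewrite lee_fin (ger0_norm (cabs_ge0 _)) normr_Re_le.
- by apply/measurable_EFinP; case: mh.
- by move=> x _ /=; rewrite lee_fin (ger0_norm (cabs_ge0 _)) normr_Im_le.
Qed.

Lemma eq_cintegral h h' : (forall x, D x -> h x = h' x) ->
  cintegral mu D h = cintegral mu D h'.
Proof.
by move=> hh'; rewrite /cintegral; congr (_ +i* _); apply: eq_Rintegral => x
  /set_mem Dx; rewrite hh'.
Qed.

Lemma eq_cintegrable h h' : (forall x, D x -> h x = h' x) ->
  cintegrable mu D h -> cintegrable mu D h'.
Proof.
move=> hh' [iRe iIm]; split.
- by apply: eq_integrable iRe => // x /set_mem Dx; rewrite hh'.
- by apply: eq_integrable iIm => // x /set_mem Dx; rewrite hh'.
Qed.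

Lemma cintegrableD h h' : cintegrable mu D h -> cintegrable mu D h' ->
  cintegrable mu D (fun x => h x + h' x).
Proof.
move=> [? ?] [? ?]; split.
- by under eq_fun do rewrite ReD EFinD; exact: integrableD.
- by under eq_fun do rewrite ImD EFinD; exact: integrableD.
Qed.

Lemma cintegrableZl (k : R) h : cintegrable mu D h ->
  cintegrable mu D (fun x => k%:C * h x).
Proof.
move=> [? ?]; split.
- by under eq_fun do rewrite Re_mulrl EFinM; exact: integrableZl.
- by under eq_fun do rewrite Im_mulrl EFinM; exact: integrableZl.
Qed.

Lemma cintegralD h h' : cintegrable mu D h -> cintegrable mu D h' ->
  cintegral mu D (fun x => h x + h' x) = cintegral mu D h + cintegral mu D h'.
Proof.
move=> [? ?] [? ?]; apply: complex_eqP.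
- by rewrite ReD -RintegralD//; apply: eq_Rintegral => x _; rewrite ReD.
- by rewrite ImD -RintegralD//; apply: eq_Rintegral => x _; rewrite ImD.
Qed.

Lemma cintegralZl (k : R) h : cintegrable mu D h ->
  cintegral mu D (fun x => k%:C * h x) = k%:C * cintegral mu D h.
Proof.
move=> [? ?]; apply: complex_eqP.
- rewrite Re_mulrl -RintegralZl//.
  by apply: eq_Rintegral => x _; rewrite Re_mulrl.
- rewrite Im_mulrl -RintegralZl//.
  by apply: eq_Rintegral => x _; rewrite Im_mulrl.
Qed.

Lemma cintegrable_sum (I : eqType) (s : seq I) (h : I -> T -> R[i]) :
  (forall i, i \in s -> cintegrable mu D (h i)) ->
  cintegrable mu D (fun x => \sum_(i <- s) h i x).
Proof.
elim: s => [_|i s IH H].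
  under eq_fun do rewrite big_nil.
  by split; exact: integrable0.
under eq_fun do rewrite big_cons.
apply: cintegrableD; first by apply: H; rewrite mem_head.
by apply: IH => j js; apply: H; rewrite inE js orbT.
Qed.

Lemma cintegral_sum (I : eqType) (s : seq I) (h : I -> T -> R[i]) :
  (forall i, i \in s -> cintegrable mu D (h i)) ->
  cintegral mu D (fun x => \sum_(i <- s) h i x) =
  \sum_(i <- s) cintegral mu D (h i).
Proof.
elim: s => [_|i s IH H].
  rewrite big_nil; under eq_fun do rewrite big_nil.
  by rewrite /cintegral /= Rintegral_cst// mul0r.
rewrite big_cons -IH; last by move=> j js; apply: H; rewrite inE js orbT.
under eq_fun do rewrite big_cons.
apply: cintegralD; first by apply: H; rewrite mem_head.
by apply: cintegrable_sum => j js; apply: H; rewrite inE js orbT.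
Qed.

(* The factor 2 comes from bounding the real and imaginary parts separately. *)
Lemma le_cabs_cintegral h (B : R) : cmeasurable D h ->
  (\int[mu]_(x in D) (cabs (h x))%:E <= B%:E)%E ->
  cabs (cintegral mu D h) <= 2 * B.
Proof.
move=> mh hB.
have ih : cintegrable mu D h.
  by apply: cintegrableP => //; apply: le_lt_trans hB _; rewrite ltry.
have bnd (g : T -> R) : mu.-integrable D (EFin \o g) ->
    (forall x, `|g x| <= cabs (h x)) -> `|\int[mu]_(x in D) g x| <= B.
  move=> ig gh; have [mg goo] := integrableP _ _ _ ig.
  apply: le_trans (le_normr_Rintegral mD ig) _.
  rewrite -lee_fin /Rintegral fineK; last first.
    by rewrite ge0_fin_numE//; apply: integral_ge0 => x _; rewrite lee_fin.
  apply: le_trans hB; apply: ge0_le_integral => //.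
  - by apply/measurable_EFinP/measurableT_comp => //; exact/measurable_EFinP.
  - exact/measurable_EFinP/measurable_cabs.
  - by move=> x _; rewrite lee_fin.
case: ih => ? ?.
apply: le_trans (cabs_le _) _; rewrite mulr_natl mulr2n.
by apply: lerD; apply: bnd => // x; rewrite ?normr_Re_le ?normr_Im_le.
Qed.

Lemma bounded_cintegrable h (B : R) : (mu D < +oo)%E -> cmeasurable D h ->
  (forall x, D x -> cabs (h x) <= B) -> cintegrable mu D h.
Proof.
move=> muD mh hB; apply: cintegrableP => //.
apply: (@le_lt_trans _ _ (\int[mu]_(x in D) B%:E)%E).
  apply: ge0_le_integral => //.
  - by move=> x _; rewrite lee_fin cabs_ge0.
  - exact/measurable_EFinP/measurable_cabs.
have -> : (\int[mu]_(x in D) B%:E = B%:E * mu D)%E by exact: integral_cst.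
rewrite -(@fineK _ (mu D)) ?ge0_fin_numE//.
by rewrite -EFinM ltry.
Qed.
End integrals.
End complex_integral_theory.

(** * Lebesgue measure under diagonal maps *)

Section dilation_of_lebesgue.
Context {R : realType}.

(** The measure A |-> k |{x : k x in A}| gives each half-open interval its length, so by uniqueness
    it is Lebesgue measure; the formula is then the integral against a scaled pushforward. *)
Lemma lebesgue_measure_scale (k : R) (f : R -> \bar R) : 0 < k ->
  measurable_fun setT f -> (forall x, 0 <= f x)%E ->
  (\int[lebesgue_measure]_x f x =
   k%:E * \int[lebesgue_measure]_x f (k * x)%R)%E.
Proof.
move=> k0 mf f0.
pose kx (x : measurableTypeR R) : measurableTypeR R := k * x.
have mk : measurable_fun setT kx by exact: mulrl_measurable.
pose kn : {nonneg R} := NngNum (ltW k0).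
pose mu := mscale kn (pushforward (@lebesgue_measure R) kx).
have E A : measurable A -> lebesgue_measure A = mu mk A.
  apply: (lebesgue_measure_unique (mu := mu mk)) => _ [[a b] _ <-].
  have kxE : kx @^-1` `]a, b] = `]a / k, b / k]%classic.
    by apply/seteqP; split=> x; rewrite /= !in_itv/= /kx
      ltr_pdivrMr// ler_pdivlMr// mulrC.
  transitivity (k%:E * lebesgue_measure (kx @^-1` `]a, b]))%E; last by [].
  rewrite kxE.
  rewrite !lebesgue_measure_itv/= !lte_fin ltr_pM2r ?invr_gt0//.
  case: ifPn => _; last by rewrite mule0.
  by rewrite -!EFinB -EFinM -mulrBl mulrCA divff ?mulr1// gt_eqF.
rewrite (eq_measure_integral (mu mk)); last by move=> A mA _; exact: E.
by rewrite ge0_integral_mscale//= ge0_integral_pushforward.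
Qed.

Lemma measurable_diag d (k : 'I_d -> R) :
  measurable_fun [set: borel 'rV[R]_d]
    (fun t => \row_i (k i * t ord0 i) : borel 'rV[R]_d).
Proof.
apply: measurable_rV => i.
under eq_fun do rewrite mxE.
by apply: measurable_funM => //; exact: measurable_coord.
Qed.

(** Tonelli with the first coordinate innermost, so that the outer integral is again over the
    measure of the previous dimension and an induction on [d] can act on it. *)
Lemma ge0_integral_lebesgue_step d
    (m : {sigma_finite_measure set (borel 'rV[R]_d) -> \bar R})
    (g : borel 'rV[R]_d.+1 -> \bar R) :
  measurable_fun setT g -> (forall x, 0 <= g x)%E ->
  (\int[lebesgue_step m]_x g x =
   \int[m]_y \int[lebesgue_measure]_x g (consrV (x, y)))%E.
Proof.
move=> mg g0; have mc := @measurable_consrV R d.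
pose mu : {measure set (measurableTypeR R * borel 'rV[R]_d) -> \bar R} :=
  (@lebesgue_measure R \x m)%E.
pose cons : measurableTypeR R * borel 'rV[R]_d -> borel 'rV[R]_d.+1 :=
  @consrV R d.
have {}mc : measurable_fun setT cons by exact: mc.
pose nu := pushforward mu cons.
rewrite (eq_measure_integral nu); last by [].
rewrite (ge0_integral_pushforward mc)// preimage_setT /mu.
rewrite fubini_tonelli2//; first exact: (measurableT_comp mg mc).
by move=> x; exact: g0.
Qed.

Lemma consrV_diag d (k : 'I_d.+1 -> R) x (y : borel 'rV[R]_d) :
  \row_i (k i * (consrV (x, y) : 'rV_d.+1) ord0 i) =
  consrV (k ord0 * x, \row_i (k (lift ord0 i) * y ord0 i)).
Proof.
have cons0 u (v : borel 'rV[R]_d) : (consrV (u, v) : 'rV_d.+1) ord0 ord0 = u.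
  by have [] := consrVK (u, v).
have consS u (v : borel 'rV[R]_d) j :
    (consrV (u, v) : 'rV_d.+1) ord0 (lift ord0 j) = v ord0 j.
  have [_ /rowP/(_ j)] := consrVK (u, v); rewrite mxE => <-.
  by congr (consrV _ _ _); exact: val_inj.
apply/rowP => i; rewrite mxE.
by case: (unliftP ord0 i) => [j|] ->; rewrite ?cons0 ?consS ?mxE.
Qed.

(** Induction on [d]: the induction hypothesis rescales the outer integral over the last
    coordinates, and [lebesgue_measure_scale] the inner one over the first. For [d = 0] the product
    is empty and the only point is fixed. *)
Lemma lebesgue_rV_diag d (k : 'I_d -> R) (f : borel 'rV[R]_d -> \bar R) :
  (forall i, 0 < k i) -> measurable_fun setT f -> (forall x, 0 <= f x)%E ->
  (\int[lebesgue_rV d]_x f x =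
   (\prod_i k i)%:E * \int[lebesgue_rV d]_x f (\row_i (k i * x ord0 i))%R)%E.
Proof.
elim: d => [|d IH] in k f * => k0 mf f0.
  rewrite big_ord0 mul1e; apply: eq_integral => x _; congr f.
  by apply/rowP => -[].
have mfk : measurable_fun setT (fun x : borel 'rV[R]_d.+1 =>
    f (\row_i (k i * x ord0 i))).
  exact: (measurableT_comp mf (measurable_diag k)).
have mfc : measurable_fun setT (f \o @consrV R d).
  exact: (measurableT_comp mf (@measurable_consrV R d)).
have mfkc := measurableT_comp mfk (@measurable_consrV R d).
rewrite !ge0_integral_lebesgue_step// big_ord_recl EFinM -muleA.
pose slice (g : borel 'rV[R]_d.+1 -> \bar R) y :=
  (\int[lebesgue_measure]_x g (consrV (x, y)))%E.
have mslice g : measurable_fun setT (g \o @consrV R d) ->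
    (forall x, 0 <= g x)%E -> measurable_fun setT (slice g).
  move=> mg g0.
  apply: (@measurable_fun_fubini_tonelli_G _ _ (measurableTypeR R)
    (borel 'rV[R]_d) R (@lebesgue_measure R) (g \o @consrV R d)) => //.
  by move=> x; exact: g0.
rewrite (IH (fun i => k (lift ord0 i)) (slice f))//; last 2 first.
- exact: mslice.
- by move=> y; exact: integral_ge0.
rewrite muleCA; congr (_ * _)%E.
rewrite -ge0_integralZl_EFin//; last 3 first.
- by move=> y _; exact: integral_ge0.
- exact: mslice mfkc _.
- exact: ltW.
apply: eq_integral => y _; rewrite /slice.
under [in RHS]eq_integral do rewrite consrV_diag.
apply: (@lebesgue_measure_scale _ (fun x => f (consrV (x, _)))) => //.
exact: measurable_fun_pair1 mfc.
Qed.

End dilation_of_lebesgue.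

(** * Change of variables and slices *)

Section change_of_variables.
Context {R : realType}.

(* The hypothesis is applied to the positive and negative parts of g, which
   requires neither theta to be measurable nor g to be integrable. *)
Lemma change_of_variables_signed d1 d2 (T1 : measurableType d1)
    (T2 : measurableType d2) (mu : {measure set T1 -> \bar R})
    (nu : {measure set T2 -> \bar R}) (A : set T1) (C : set T2)
    (theta : T2 -> T1) (w : T2 -> R) : measurable A ->
  (forall t, C t -> 0 <= w t) ->
  (forall t, C t -> 0 < w t -> A (theta t)) ->
  (forall psi : T1 -> \bar R, measurable_fun setT psi ->
     (forall u, 0 <= psi u)%E ->
     \int[mu]_(u in A) psi u =
     \int[nu]_(t in C) (psi (theta t) * (w t)%:E))%E ->
  forall g : T1 -> R, measurable_fun A g ->
    (\int[mu]_(u in A) (g u)%:E = \int[nu]_(t in C) (g (theta t) * w t)%:E)%E.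
Proof.
move=> mA w0 thetaA H g mg.
(* The hypothesis asks for functions measurable on the whole space, whereas [g] is measurable only
   on [A]. *)
have mgA : measurable_fun setT ((EFin \o g) \_ A).
  by apply: (measurable_restrictT _ _).1 => //; exact/measurable_EFinP.
have gA u : A u -> ((EFin \o g) \_ A) u = (g u)%:E.
  by move=> Au; rewrite patchE mem_set.
transitivity (\int[mu]_(u in A) ((EFin \o g) \_ A) u)%E.
  by apply: eq_integral => u /set_mem /gA.
rewrite integralE [RHS]integralE; congr (_ - _)%E.
- rewrite H//; last exact: measurable_funepos.
  apply: eq_integral => t /set_mem Ct; rewrite !funeposE.
  (* Where [w t = 0] the point [theta t] may lie outside [A], but both integrands vanish; elsewhere
     the extension agrees with [g], and a positive weight commutes with the maximum. *)
  have := w0 _ Ct; rewrite le_eqVlt => /predU1P[<-|wt].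
    by rewrite mule0 mulr0 maxxx.
  rewrite gA; last exact: thetaA.
  by rewrite -!EFin_max -EFinM maxr_pMl ?mul0r// ltW.
- rewrite H//; last exact: measurable_funeneg.
  apply: eq_integral => t /set_mem Ct; rewrite !funenegE.
  have := w0 _ Ct; rewrite le_eqVlt => /predU1P[<-|wt].
    by rewrite mule0 mulr0 oppe0 maxxx.
  rewrite gA; last exact: thetaA.
  by rewrite -!EFinN -!EFin_max -EFinM maxr_pMl ?mul0r ?mulNr// ltW.
Qed.

(** Composition alone does not suffice, since [theta] may leave [A]. This happens only where [w]
    vanishes, so [g] can be replaced in the product by its extension by zero. *)
Lemma measurable_transport d1 d2 (T1 : measurableType d1)
    (T2 : measurableType d2) (A : set T1) (C : set T2) (theta : T2 -> T1)
    (w : T2 -> R) : measurable A ->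
  (forall t, C t -> 0 <= w t) ->
  (forall t, C t -> 0 < w t -> A (theta t)) ->
  measurable_fun C theta -> measurable_fun C w ->
  forall g : T1 -> R, measurable_fun A g ->
    measurable_fun C (fun t => g (theta t) * w t).
Proof.
move=> mA w0 thetaA mtheta mw g mg.
have mgA : measurable_fun setT (g \_ A) by exact: (measurable_restrictT _ _).1.
apply: (@eq_measurable_fun _ _ _ _ _ (fun t => (g \_ A) (theta t) * w t)).
  move=> t /set_mem Ct.
  have := w0 _ Ct; rewrite le_eqVlt => /predU1P[<-|wt]; first by rewrite !mulr0.
  by rewrite patchE mem_set//; exact: thetaA.
by apply: measurable_funM => //; exact: (measurableT_comp mgA mtheta).
Qed.

Section complex_change_of_variables.
Context {d1 d2} {T1 : measurableType d1} {T2 : measurableType d2}.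
Variables (mu : {measure set T1 -> \bar R}) (nu : {measure set T2 -> \bar R}).
Variables (A : set T1) (C : set T2) (theta : T2 -> T1) (w : T2 -> R).
Hypotheses (mA : measurable A) (w0 : forall t, C t -> 0 <= w t)
  (thetaA : forall t, C t -> 0 < w t -> A (theta t))
  (mtheta : measurable_fun C theta) (mw : measurable_fun C w)
  (change : forall psi : T1 -> \bar R, measurable_fun setT psi ->
     (forall u, 0 <= psi u)%E ->
     (\int[mu]_(u in A) psi u =
      \int[nu]_(t in C) (psi (theta t) * (w t)%:E))%E).
Variable g : T1 -> R[i].
Hypothesis mg : cmeasurable A g.
Let gw t := (w t)%:C * g (theta t).

Let Re_gw t : complex.Re (gw t) = complex.Re (g (theta t)) * w t.
Proof. by rewrite Re_mulrl mulrC. Qed.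

Let Im_gw t : complex.Im (gw t) = complex.Im (g (theta t)) * w t.
Proof. by rewrite Im_mulrl mulrC. Qed.

Lemma cmeasurable_transport : cmeasurable C gw.
Proof.
have [mRe mIm] := mg; split.
- by under eq_fun do rewrite Re_gw;
    exact: (measurable_transport mA w0 thetaA mtheta mw mRe).
- by under eq_fun do rewrite Im_gw;
    exact: (measurable_transport mA w0 thetaA mtheta mw mIm).
Qed.

Lemma cintegral_transport : cintegral mu A g = cintegral nu C gw.
Proof.
have [mRe mIm] := mg; rewrite /cintegral /Rintegral; congr (fine _ +i* fine _).
- under [RHS]eq_integral do rewrite Re_gw.
  exact: (change_of_variables_signed mA w0 thetaA change).
- under [RHS]eq_integral do rewrite Im_gw.
  exact: (change_of_variables_signed mA w0 thetaA change).
Qed.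

(** The change of variables for the absolute values of the real and imaginary parts equates the two
    integrals. This direction is the one needed, because finiteness is first obtained on the
    reference cell. *)
Lemma cintegrable_transport : cintegrable nu C gw -> cintegrable mu A g.
Proof.
have [mRe mIm] := mg; move=> [/integrableP[_ iRe] /integrableP[_ iIm]].
have abs_change (h : T1 -> R) : measurable_fun A h ->
    (\int[mu]_(u in A) `|(h u)%:E| =
     \int[nu]_(t in C) `|(h (theta t) * w t)%:E|)%E.
  move=> mh; rewrite (change_of_variables_signed mA w0 thetaA change
    (g := fun u => `|h u|)); last exact: measurableT_comp.
  by apply: eq_integral => t /set_mem Ct; rewrite /= normrM (ger0_norm (w0 Ct)).
split; apply/integrableP; split; try exact/measurable_EFinP.
- rewrite abs_change//; apply: le_lt_trans iRe.
  by under [leRHS]eq_integral do rewrite Re_gw.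
- rewrite abs_change//; apply: le_lt_trans iIm.
  by under [leRHS]eq_integral do rewrite Im_gw.
Qed.

End complex_change_of_variables.

End change_of_variables.

Section sections.
Context {R : realType} {d1 d2 : measure_display}.
Context {T1 : measurableType d1} {T2 : measurableType d2}.
Variables (P : set T1) (C : T1 -> set T2).
Let gr : set (T1 * T2) := [set x | P x.1 /\ C x.1 x.2].
Hypothesis mgr : measurable gr.

Lemma measurable_slice p : P p -> measurable (C p).
Proof.
move=> Pp; rewrite (_ : C p = xsection gr p); first exact: measurable_xsection.
by apply/seteqP; split=> t; rewrite /xsection/= inE; [|case].
Qed.

Lemma measurable_fun_slice d3 (T3 : measurableType d3) (h : T1 * T2 -> T3) p :
  P p -> measurable_fun gr h -> measurable_fun (C p) (fun t => h (p, t)).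
Proof.
move=> Pp mh; apply: (measurable_comp mgr) mh _.
  by move=> _ [t Ct <-].
exact: measurable_funTS (pair1_measurable p).
Qed.

Variable m : {sigma_finite_measure set T2 -> \bar R}.

(** After extension by zero off the graph, Tonelli makes the integrals of the positive and negative
    parts measurable in [p]; their difference and then [fine] preserve this, even at points where a
    slice has an infinite integral. *)
Lemma measurable_integral_slice (h : T1 * T2 -> R) : measurable_fun gr h ->
  measurable_fun P (fun p => \int[m]_(t in C p) h (p, t)).
Proof.
move=> mh.
have mhgr : measurable_fun setT ((EFin \o h) \_ gr).
  by apply: (measurable_restrictT _ _).1 => //; exact/measurable_EFinP.
have mfub (f : T1 * T2 -> \bar R) : measurable_fun setT f ->
    (forall x, 0 <= f x)%E ->
    measurable_fun P (fun p => \int[m]_t f (p, t))%E.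
  move=> mf f0; apply: measurable_funTS.
  exact: measurable_fun_fubini_tonelli_F.
apply: (@eq_measurable_fun _ _ _ _ _ (fine \o (fun p =>
  \int[m]_t ((EFin \o h) \_ gr)^\+ (p, t) -
  \int[m]_t ((EFin \o h) \_ gr)^\- (p, t))%E)).
  move=> p /set_mem Pp; rewrite /Rintegral /=; congr fine; apply/esym.
  rewrite integral_mkcond integralE.
  have E t : ((fun t => (h (p, t))%:E) \_ (C p)) t = ((EFin \o h) \_ gr) (p, t).
    rewrite !patchE; congr (if _ then _ else _); apply/idP/idP.
      by move=> /set_mem Ct; apply/mem_set.
    by move=> /set_mem[_ Ct]; apply/mem_set.
  by congr (_ - _)%E; apply: eq_integral => t _; rewrite ?funeposE ?funenegE E.
apply: measurableT_comp; first exact: fine_measurable.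
apply: emeasurable_funB; apply: mfub => //.
- exact: measurable_funepos.
- exact: measurable_funeneg.
Qed.

Lemma cmeasurable_cintegral_slice (h : T1 * T2 -> R[i]) : cmeasurable gr h ->
  cmeasurable P (fun p => cintegral m (C p) (fun t => h (p, t))).
Proof.
move=> [mRe mIm]; split => /=.
- exact: (measurable_integral_slice mRe).
- exact: (measurable_integral_slice mIm).
Qed.

Lemma cmeasurable_slice (h : T1 * T2 -> R[i]) p : P p -> cmeasurable gr h ->
  cmeasurable (C p) (fun t => h (p, t)).
Proof.
move=> Pp [mRe mIm]; split.
- exact: (measurable_fun_slice Pp mRe).
- exact: (measurable_fun_slice Pp mIm).
Qed.

End sections.

(** * Measurability on manifolds, cells *)

Section borel_measurability.

(* Only T needs to be second countable: the second factors are the largest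
   open sets W b such that b `*` W b is contained in O. *)
Lemma measurable_open_prod (T U : ptopologicalType) (O : set (T * U)) :
  @second_countable T -> open O -> measurable (O : set (borel T * borel U)).
Proof.
move=> [B cB [oB baseB]] oO.
pose W (b : set T) : set U := interior [set y | forall x, b x -> O (x, y)].
have -> : O = \bigcup_(b : B) (set_val b `*` W (set_val b)).
  apply/seteqP; split=> [[x y] Oxy|[x y] [b _ [/= bx /interior_subset]]];
    last exact.
  have [[A1 A2] /= [nA1 nA2] A12] : nbhs (x, y) O by exact: open_nbhs_nbhs.
  have [b [Bb bx] bA1] := baseB x _ nA1.
  exists (exist _ b (mem_set Bb)) => //; split => //=.
  by apply: filterS nA2 => y' A2y' x' bx'; apply: A12; split=> //; exact: bA1.
apply: countable_bigcupT_measurable => [|b].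
  by rewrite (eq_countable (card_setT B)).
apply: (@measurableX _ _ (borel T) (borel U)); apply: borel_open.
  by apply: oB; exact: set_mem (valP b).
exact: open_interior.
Qed.

(** Within [D] the preimage of an open set is the trace of an open set of the product, which is
    measurable by [measurable_open_prod]. Cutting down to [E] lets the measurable graph of the cut
    cells stand in for the domain of the normal map, whose measurability is not established. *)
Lemma measurable_within_continuous (T U V : ptopologicalType) (f : T * U -> V)
    (D E : set (T * U)) : @second_countable T -> {within D, continuous f} ->
  E `<=` D -> measurable_fun (E : set (borel T * borel U)) (f : _ -> borel V).
Proof.
move=> sT /continuousP cf ED mE.
(* Introducing [mE] has unfolded [measurable_fun]; the goal is restated in its folded form with [mE]
   at hand. *)
suff mf : measurable_fun (E : set (borel T * borel U)) (f : _ -> borel V).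
  exact: mf.
have EV : @measurable _ (borel V) = <<s @open V >> by [].
apply: (@measurability _ _ (borel T * borel U)%type (borel V) E f _ EV).
move=> _ [W oW <-].
have /open_subspaceP [Z oZ ZD] := cf W oW.
rewrite (_ : E `&` f @^-1` W = E `&` Z).
  by apply: measurableI => //; exact: measurable_open_prod.
apply/seteqP; split=> x [Ex Hx]; split=> //.
- have : (f @^-1` W `&` D) x by split=> //; exact: ED.
  by rewrite -ZD => -[].
- have : (Z `&` D) x by split=> //; exact: ED.
  by rewrite ZD => -[].
Qed.

Lemma borel_continuous_measurable {R : realType} (T : ptopologicalType)
  (f : T -> R) : continuous f -> measurable_fun setT (f : borel T -> R).
Proof.
move=> /continuousP cf.
apply: (measurability _ (RGenOpens.measurableE R)) => _ [_ [a [b ->]] <-].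
by rewrite setTI; apply: borel_open; apply: cf; exact: interval_open.
Qed.

Lemma measurable_eball {R : realType} d (r : R) :
  measurable (eball r : set (borel 'rV[R]_d)).
Proof.
have mn : measurable_fun [set: borel 'rV[R]_d]
    (@enorm R d : borel 'rV[R]_d -> R).
  apply: (measurableT_comp (f := Num.sqrt : R -> R)).
    exact: continuous_measurable_fun (@sqrt_continuous R).
  apply: measurable_sum => i; apply: measurable_funX.
  exact: measurable_coord.
have := mn measurableT _ (measurable_itv `]-oo, r[).
by rewrite setTI.
Qed.

End borel_measurability.

Section cells.
Context {R : realType} {N : ptopologicalType} {d : nat}.

Lemma measurable_cut_cell_graph (P : set N) (A : N -> set 'rV[R]_d) (eps : R) :
  measurable (graph P A) -> measurable (graph P (cut_cell A eps)).
Proof.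
move=> mA.
rewrite (_ : graph P _ = graph P A `&` setT `*` eball eps).
  apply: measurableI => //; apply: measurableX => //.
  exact: measurable_eball.
by apply/seteqP; split=> -[p s] /=; [move=> [? [? ?]]|move=> [[? ?] [? ?]]].
Qed.

Lemma cmeasurable_cell_integrand (D : set (borel N * borel 'rV[R]_d))
    (f : N -> R) (a : borel N -> R[i]) (F : N -> 'rV[R]_d -> N)
    (J : N -> 'rV[R]_d -> R) (z : R) :
  continuous f -> cmeasurable setT a ->
  measurable_fun D (fun ps => F ps.1 ps.2 : borel N) ->
  measurable_fun D (fun ps => J ps.1 ps.2) ->
  cmeasurable D (fun ps => cell_integrand f a F J z ps.1 ps.2).
Proof.
move=> cf [mRe mIm] mF mJ.
rewrite /cell_integrand; under eq_fun do rewrite mulrC.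
apply: cmeasurable_mulrl; last first.
  by split; [exact: (measurableT_comp mRe mF)|exact: (measurableT_comp mIm mF)].
apply: measurable_funM => //.
apply: (measurableT_comp (f := @expR R)); first exact: measurable_expR.
apply: measurable_funM => //.
exact: (measurableT_comp (borel_continuous_measurable cf) mF).
Qed.

Lemma powR_sum (q : R) (I : Type) (s : seq I) (b : I -> R) : 0 < q ->
  \prod_(i <- s) q `^ b i = q `^ (\sum_(i <- s) b i).
Proof.
move=> q0; elim: s => [|i s IH]; first by rewrite !big_nil powRr0.
by rewrite !big_cons IH powRD// (gt_eqF q0) implybT.
Qed.

Lemma dilationVK (beta : 'I_d -> R) (q : R) : 0 < q ->
  cancel (dilation beta q^-1) (dilation beta q).
Proof.
move=> q0 t; apply/rowP => i; rewrite !mxE mulrA -powRM ?invr_ge0 ?ltW//.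
by rewrite divff ?gt_eqF// powR1 mul1r.
Qed.

Lemma dilationK (beta : 'I_d -> R) (q : R) : 0 < q ->
  cancel (dilation beta q) (dilation beta q^-1).
Proof.
by move=> q0 t; have := @dilationVK beta q^-1 _ t; rewrite invrK invr_gt0 => ->.
Qed.

Lemma scaled_cellE (beta : 'I_d -> R) (A : N -> set 'rV[R]_d) eps q p u :
  0 < q ->
  scaled_cell beta A eps q p u <-> cut_cell A eps p (dilation beta q u).
Proof.
move=> q0; split=> [[s As <-]|Au]; first by rewrite dilationVK.
by exists (dilation beta q u) => //; exact: dilationK.
Qed.

(** Dilation and cell representation are merged into one substitution, with map D_q Theta_q and
    weight q^Q jq, the shape that the transport lemmas take. *)
Lemma cell_change (P : set N) (A C : N -> set 'rV[R]_d) eps (beta : 'I_d -> R)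
    Theta jq q p (psi : borel 'rV[R]_d -> \bar R) :
  scaled_cell_representation P (scaled_cell beta A eps) C Theta jq ->
  0 < q -> P p -> measurable (cut_cell A eps p : set (borel 'rV[R]_d)) ->
  measurable_fun setT psi -> (forall u, 0 <= psi u)%E ->
  (\int[lebesgue_rV d]_(s in cut_cell A eps p) psi s =
   \int[lebesgue_rV d]_(t in C p) (psi (dilation beta q (Theta q p t)) *
     (q `^ (\sum_i beta i) * jq q p t)%:E))%E.
Proof.
move=> CP q0 Pp mcut mpsi psi0.
have mdil : measurable_fun setT
    (dilation beta q : borel 'rV[R]_d -> borel 'rV[R]_d).
  exact: measurable_diag.
have Q0 : 0 <= q `^ (\sum_i beta i) by exact: powR_ge0.
pose psi' (u : borel 'rV[R]_d) :=
  ((q `^ (\sum_i beta i))%:E * psi (dilation beta q u))%E.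
have mpsi' : measurable_fun setT psi'.
  exact: (measurable_funeM _ (measurableT_comp mpsi mdil)).
(* Pulling q^Q out of the integral over C p instead would require slicing the
   joint measurability of Theta and jq. *)
transitivity (\int[lebesgue_rV d]_(u in scaled_cell beta A eps q p) psi' u)%E.
  (* The formula for diagonal maps concerns the whole space, so the cut cell enters as a
     restriction, which the dilation turns into the restriction to the scaled cell. *)
  have mpsicut : measurable_fun setT
      (psi \_ (cut_cell A eps p) : borel 'rV[R]_d -> \bar R).
    by apply: (measurable_restrictT _ _).1 => //; exact: measurable_funTS.
  rewrite integral_mkcond (lebesgue_rV_diag (k := fun i => q `^ beta i))//;
    last 2 first.
  - by move=> i; exact: powR_gt0.
  - by move=> u; apply: erestrict_ge0 => v _.
  rewrite powR_sum// [RHS]integral_mkcond -ge0_integralZl_EFin//; last 2 first.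
  - by move=> u _; apply: erestrict_ge0 => v _.
  - exact: (measurableT_comp mpsicut mdil).
  apply: eq_integral => u _; rewrite !patchE.
  have -> : (u \in scaled_cell beta A eps q p) =
      (dilation beta q u \in cut_cell A eps p).
    by apply/idP/idP => /set_mem H; apply/mem_set; apply/scaled_cellE.
  by case: ifP => //; rewrite mule0.
rewrite (sc_change CP)//; last by move=> u; rewrite mule_ge0// lee_fin.
by apply: eq_integral => t _; rewrite /psi' EFinM muleAC muleC.
Qed.

End cells.

(** * The expansion *)

Section expansion.
Context {R : realType} {N : ptopologicalType} {d : nat}.
Variables (P : set (borel N)) (A C : N -> set 'rV[R]_d) (eps : R).
Variables (beta : 'I_d -> R) (Theta : R -> N -> 'rV[R]_d -> 'rV[R]_d).
Variable jq : R -> N -> 'rV[R]_d -> R.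
Hypothesis CP :
  scaled_cell_representation P (scaled_cell beta A eps) C Theta jq.
Variables (f : N -> R) (f0 : R) (a : borel N -> R[i]) (F : N -> 'rV[R]_d -> N).
Variables (J : N -> 'rV[R]_d -> R) (c : borel N -> R) (G : N -> 'rV[R]_d -> R).
Hypothesis c_gt0 : forall p, P p -> 0 < c p.
Hypothesis mcut : measurable (graph P (cut_cell A eps)).
Hypothesis mg : forall z, cmeasurable (graph P (cut_cell A eps))
  (fun ps => cell_integrand f a F J z ps.1 ps.2).
Let Q := \sum_i beta i.
Let D_ := transported_density beta Theta jq (amplitude a F J)
           (phase f f0 F c) G.
Let Iz := cell_integral f a F J A eps.

Lemma transported_integrand z p q t : 0 < q -> P p -> C p t ->
  z * (q * c p) = 1 ->
  (q `^ Q * jq q p t)%:C *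
    cell_integrand f a F J z p (dilation beta q (Theta q p t)) =
  (expR (- z * f0) * q `^ Q)%:C * (D_ q p t * (expR (- G p t))%:C).
Proof.
move=> q0 Pp Ct zqc.
rewrite /D_ /transported_density /transported_amplitude /transported_phase.
(* Where [jq] vanishes both sides are 0, by the convention on the transported amplitude. *)
have := sc_jq_ge0 CP q0 Pp Ct; rewrite le_eqVlt => /predU1P[<-|j0].
  by rewrite ltxx mulr0 !mul0r mulr0.
rewrite j0 /cell_integrand /amplitude; set s := dilation _ _ _.
have -> : expR (- z * f (F p s)) = expR (- z * f0) *
    expR (G p t - q^-1 * phase f f0 F c p s) * expR (- G p t).
  have zE : z = q^-1 / c p.
    have q0' := lt0r_neq0 q0; have c0' := lt0r_neq0 (c_gt0 Pp).
    by rewrite -[RHS]mul1r -zqc; field; rewrite q0' c0'.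
  rewrite -!expRD /phase zE; congr expR; ring.
rewrite !rmorphM /=; ring.
Qed.

Lemma measurable_scaled_slice p q : 0 < q -> P p ->
  measurable_fun (C p : set (borel 'rV[R]_d)) (Theta q p : _ -> borel 'rV[R]_d)
  /\ measurable_fun (C p : set (borel 'rV[R]_d)) (jq q p).
Proof.
move=> q0 Pp.
have mdom : measurable ([set q : R | 0 < q] `*` graph P C).
  apply: measurableX; last exact: sc_graph CP.
  have := measurable_itv `]0, +oo[ : measurable (_ : set R).
  by congr measurable; apply/seteqP; split=> x; rewrite /= in_itv/= andbT.
have sub : [set (q, (p : borel N, t)) | t in (C p : set (borel 'rV[R]_d))]
    `<=` [set q : R | 0 < q] `*` graph P C.
  by move=> _ [t Ct <-].
have mpair : measurable_fun (C p : set (borel 'rV[R]_d))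
    (fun t : borel 'rV[R]_d => (q, (p : borel N, t))).
  by apply: measurable_funTS; exact: measurable_fun_pair.
split.
- exact: (measurable_comp mdom sub (sc_Theta_meas CP) mpair).
- exact: (measurable_comp mdom sub (sc_jq_meas CP) mpair).
Qed.

(** Measurability of [H] comes out of the transport itself. Its integrability stays a premise here,
    because it will come from the assumed expansion. *)
Lemma cell_integral_transport z p q : 0 < q -> P p -> z * (q * c p) = 1 ->
  let H t := D_ q p t * (expR (- G p t))%:C in
  cmeasurable (C p : set (borel 'rV[R]_d)) H /\
  (cintegrable (lebesgue_rV d) (C p : set (borel 'rV[R]_d)) H ->
   cintegrable (lebesgue_rV d) (cut_cell A eps p : set (borel 'rV[R]_d))
     (cell_integrand f a F J z p) /\
   Iz z p = (expR (- z * f0) * q `^ Q)%:C *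
     cintegral (lebesgue_rV d) (C p : set (borel 'rV[R]_d)) H).
Proof.
move=> q0 Pp zqc H.
set k := expR (- z * f0) * q `^ Q.
have k0 : 0 < k by rewrite mulr_gt0 ?expR_gt0 ?powR_gt0.
have mcutp : measurable (cut_cell A eps p : set (borel 'rV[R]_d)).
  exact: (measurable_slice mcut Pp).
have mCp : measurable (C p : set (borel 'rV[R]_d)).
  exact: (measurable_slice (sc_graph CP) Pp).
have mgp : cmeasurable (cut_cell A eps p : set (borel 'rV[R]_d))
    (cell_integrand f a F J z p).
  exact: (cmeasurable_slice mcut Pp (mg z)).
pose theta (t : borel 'rV[R]_d) :=
  dilation beta q (Theta q p t) : borel 'rV[R]_d.
pose w (t : borel 'rV[R]_d) := q `^ Q * jq q p t.
have w0 (t : borel 'rV[R]_d) : C p t -> 0 <= w t.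
  by move=> Ct; rewrite mulr_ge0 ?powR_ge0// (sc_jq_ge0 CP).
have thetacut (t : borel 'rV[R]_d) :
    C p t -> 0 < w t -> cut_cell A eps p (theta t).
  move=> Ct; rewrite pmulr_rgt0 ?powR_gt0// => jt.
  by apply/scaled_cellE => //; exact: (sc_values CP).
have [mTheta mj] := measurable_scaled_slice q0 Pp.
have mtheta : measurable_fun (C p : set (borel 'rV[R]_d)) theta.
  exact: (measurableT_comp (measurable_diag (fun i => q `^ beta i)) mTheta).
have mw : measurable_fun (C p : set (borel 'rV[R]_d)) w.
  exact: measurable_funM.
have change (psi : borel 'rV[R]_d -> \bar R) : measurable_fun setT psi ->
    (forall u, 0 <= psi u)%E ->
    (\int[lebesgue_rV d]_(s in cut_cell A eps p) psi s =
     \int[lebesgue_rV d]_(t in C p) (psi (theta t) * (w t)%:E))%E.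
  exact: (cell_change CP).
have HE (t : borel 'rV[R]_d) : C p t ->
    (w t)%:C * cell_integrand f a F J z p (theta t) = k%:C * H t.
  by move=> Ct; exact: transported_integrand.
split.
  (* The transported integrand is measurable and equals [k] times [H]; since [k > 0] this can be
     divided out. *)
  apply: (@eq_cmeasurable _ _ _ _ (fun t : borel 'rV[R]_d =>
    (k^-1)%:C * ((w t)%:C * cell_integrand f a F J z p (theta t)))).
    move=> t Ct; rewrite HE// mulrA -rmorphM mulVf ?gt_eqF//.
    by rewrite rmorph1 mul1r.
  apply: cmeasurable_mulrl => //.
  exact: (cmeasurable_transport mcutp w0 thetacut mtheta mw mgp).
move=> iH; split.
  apply: (cintegrable_transport mcutp w0 thetacut change mgp).
  by apply: eq_cintegrable (cintegrableZl mCp k iH) => // t Ct; rewrite HE.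
rewrite /Iz /cell_integral.
rewrite (cintegral_transport mcutp w0 thetacut change mgp) -cintegralZl//.
exact: eq_cintegral.
Qed.

(** * Expansion at a fixed z and p *)

Variables (rho : R) (Lam : {fset R}) (D : R -> N -> 'rV[R]_d -> R[i]).
Variable B : R -> R.
Hypothesis G_meas : measurable_fun
  (P `*` setT : set (borel N * borel 'rV[R]_d)) (fun pt => G pt.1 pt.2).
Hypothesis D_meas : forall la, la \in Lam ->
  cmeasurable (graph P C) (fun pt => D la pt.1 pt.2).
Hypothesis D_bnd : forall la p, la \in Lam -> P p ->
  (\int[lebesgue_rV d]_(t in C p)
     (cabs (D la p t) * expR (- G p t))%:E <= (B la)%:E)%E.
Let W la p (t : borel 'rV[R]_d) := D la p t * (expR (- G p t))%:C.
Let L la p := cintegral (lebesgue_rV d) (C p : set (borel 'rV[R]_d)) (W la p).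

Lemma cabs_weight (w : R[i]) (x : R) : cabs (w * (expR x)%:C) = cabs w * expR x.
Proof. by rewrite cabsM cabs_real ger0_norm ?expR_ge0. Qed.

Lemma cmeasurable_weighted la : la \in Lam -> measurable P ->
  cmeasurable (graph P C) (fun pt => W la pt.1 pt.2).
Proof.
move=> laL mP; rewrite /W; under eq_fun do rewrite mulrC.
apply: cmeasurable_mulrl; last exact: D_meas.
apply: (measurableT_comp (f := @expR R)); first exact: measurable_expR.
apply: measurableT_comp => //; apply: measurable_funS G_meas.
  by apply: measurableX.
by move=> [p t] [].
Qed.

Lemma cintegrable_weighted la p : la \in Lam -> measurable P -> P p ->
  cintegrable (lebesgue_rV d) (C p : set (borel 'rV[R]_d)) (W la p).
Proof.
move=> laL mP Pp; apply: cintegrableP.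
- exact: (measurable_slice (sc_graph CP) Pp).
- exact: (cmeasurable_slice (sc_graph CP) Pp (cmeasurable_weighted laL mP)).
- under eq_integral do rewrite cabs_weight.
  by apply: le_lt_trans (D_bnd laL Pp) _; rewrite ltry.
Qed.

(** The bound does not depend on [p], which later makes the coefficients integrable over [P]. *)
Lemma le_cabs_L la p : la \in Lam -> measurable P -> P p ->
  cabs (L la p) <= 2 * B la.
Proof.
move=> laL mP Pp; apply: le_cabs_cintegral.
- exact: (measurable_slice (sc_graph CP) Pp).
- exact: (cmeasurable_slice (sc_graph CP) Pp (cmeasurable_weighted laL mP)).
- by under eq_integral do rewrite cabs_weight; exact: D_bnd.
Qed.

Let main z p := (expR (- z * f0))%:C *
  \sum_(la <- Lam) (z `^ (- (Q + la)))%:C * (c p `^ (- (Q + la)))%:C * L la p.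

Lemma powR_scale z p q x : 0 < q -> P p -> z * (q * c p) = 1 ->
  z `^ (- x) * c p `^ (- x) = q `^ x.
Proof.
move=> q0 Pp zqc; have c0 := c_gt0 Pp.
have qc0 : 0 < q * c p by rewrite mulr_gt0.
have z0 : 0 < z by rewrite -(pmulr_lgt0 _ qc0) zqc.
have : z `^ x * (q `^ x * c p `^ x) = 1.
  by rewrite -!powRM ?ltW ?mulr_gt0// zqc powR1.
have zx := powR_gt0 x z0; have cx := powR_gt0 x c0.
rewrite !powRN => E; rewrite -[RHS]mulr1 -[in LHS](mulr1 (_^-1 * _)) -{1}E.
by field; rewrite !gt_eqF.
Qed.

(** Split [H = Er + S], with [S] the weighted partial sum. The hypothesis bounds the integral of
    |Er| by e q^rho, so [Er], hence [H], hence the cell integrand are integrable. By linearity the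
    [S] part is exactly [main], and only the integral of [Er], times e^(- z f0) q^Q, remains. *)
Lemma expansion_at z p q e : measurable P -> 0 < q -> P p ->
  z * (q * c p) = 1 ->
  ((q `^ (- rho))%:E * \int[lebesgue_rV d]_(t in C p)
     (cabs (D_ q p t - \sum_(la <- Lam) (q `^ la)%:C * D la p t)
        * expR (- G p t))%:E <= e%:E)%E ->
  cintegrable (lebesgue_rV d) (cut_cell A eps p : set (borel 'rV[R]_d))
     (cell_integrand f a F J z p) /\
  cabs (Iz z p - main z p) <= 2 * e * (expR (- z * f0) * q `^ (Q + rho)).
Proof.
move=> mP q0 Pp zqc.
have [] := cell_integral_transport q0 Pp zqc.
set H := (H in cmeasurable _ H) => mH transport.
set T := (T in (_ * T)%E) => Te.
have mCp := measurable_slice (sc_graph CP) Pp.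
pose S (t : borel 'rV[R]_d) := \sum_(la <- Lam) (q `^ la)%:C * W la p t.
have iS : cintegrable (lebesgue_rV d) (C p : set (borel 'rV[R]_d)) S.
  apply: cintegrable_sum => // la laL.
  by apply: cintegrableZl => //; exact: cintegrable_weighted.
pose Er (t : borel 'rV[R]_d) := H t + (-1)%:C * S t.
have mS : cmeasurable (C p : set (borel 'rV[R]_d)) S.
  by case: iS => /integrableP[? _] /integrableP[? _]; split;
    exact/measurable_EFinP.
have mEr : cmeasurable (C p : set (borel 'rV[R]_d)) Er.
  apply: cmeasurableD => //; apply: cmeasurable_mulrl => //.
have ErE t : cabs (Er t) =
    cabs (D_ q p t - \sum_(la <- Lam) (q `^ la)%:C * D la p t) * expR (- G p t).
  rewrite -cabs_weight; congr cabs.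
  rewrite /Er rmorphN1 mulN1r mulrBl mulr_suml; congr (_ - _).
  by apply: eq_bigr => la _; rewrite /W mulrA.
have intEr : (\int[lebesgue_rV d]_(t in C p) (cabs (Er t))%:E <=
    (e * q `^ rho)%:E)%E.
  under eq_integral do rewrite ErE.
  move: Te; rewrite -/T powRN lee_pdivrMl ?powR_gt0// => /le_trans; apply.
  by rewrite -EFinM mulrC.
have iEr : cintegrable (lebesgue_rV d) (C p : set (borel 'rV[R]_d)) Er.
  by apply: cintegrableP => //; apply: le_lt_trans intEr _; rewrite ltry.
have HE t : Er t + S t = H t.
  by rewrite /Er rmorphN1 mulN1r subrK.
have iH : cintegrable (lebesgue_rV d) (C p : set (borel 'rV[R]_d)) H.
  by apply: eq_cintegrable (cintegrableD mCp iEr iS) => // t _; exact: HE.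
have [ig IzE] := transport iH; split => //.
set k := expR (- z * f0) * q `^ Q in IzE.
have k0 : 0 <= k by rewrite mulr_ge0 ?expR_ge0 ?powR_ge0.
have SE : k%:C * cintegral (lebesgue_rV d) (C p : set (borel 'rV[R]_d)) S =
    main z p.
  rewrite cintegral_sum//; last first.
    by move=> la laL; apply: cintegrableZl => //; exact: cintegrable_weighted.
  rewrite /main /k rmorphM -mulrA; congr (_ * _); rewrite mulr_sumr.
  rewrite big_seq [RHS]big_seq; apply: eq_bigr => la laL.
  rewrite cintegralZl//; last exact: cintegrable_weighted.
  rewrite -rmorphM (powR_scale _ q0 Pp zqc) mulrA -rmorphM.
  by rewrite powRD// (gt_eqF q0) implybT.
have -> : Iz z p - main z p =
    k%:C * cintegral (lebesgue_rV d) (C p : set (borel 'rV[R]_d)) Er.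
  rewrite -SE IzE -mulrBr; congr (_ * _).
  rewrite -(@eq_cintegral _ _ _ _ _ (fun t => Er t + S t)); last by move=> t _.
  by rewrite cintegralD// addrK.
rewrite cabsM cabs_real ger0_norm//.
apply: le_trans (ler_wpM2l k0 (le_cabs_cintegral mCp mEr intEr)) _.
rewrite powRD ?(gt_eqF q0) ?implybT//.
rewrite [leRHS](_ : _ = k * (2 * (e * q `^ rho)))// /k; ring.
Qed.

(** * Uniformity in p *)

Variable cmin : R.
Hypothesis cmin_gt0 : 0 < cmin.
Hypothesis cmin_le : forall p, P p -> cmin <= c p.
Hypothesis beta_ge0 : forall i, 0 <= beta i.
Hypothesis rho_ge0 : 0 <= rho.
Hypothesis D_exp : forall e, 0 < e -> exists2 delta, 0 < delta &
  forall q p, 0 < q < delta -> P p ->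
  ((q `^ (- rho))%:E * \int[lebesgue_rV d]_(t in C p)
     (cabs (D_ q p t - \sum_(la <- Lam) (q `^ la)%:C * D la p t)
        * expR (- G p t))%:E <= e%:E)%E.

Lemma expansion_uniform e : measurable P -> 0 < e ->
  \forall z \near +oo, forall p, P p ->
    cintegrable (lebesgue_rV d) (cut_cell A eps p : set (borel 'rV[R]_d))
      (cell_integrand f a F J z p) /\
    cabs (Iz z p - main z p) <= e * (expR (- z * f0) * z `^ (- (Q + rho))).
Proof.
move=> mP e0; set x := Q + rho.
have x0 : 0 <= x by rewrite addr_ge0// sumr_ge0.
have cx0 : 0 < cmin `^ x by exact: powR_gt0.
(* The 2 cancels the factor in [expansion_at]; cmin^x absorbs the c(p)^(-x) left when q^x is
   rewritten as z^(-x) c(p)^(-x). *)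
have [|delta delta0 Hdelta] := D_exp (e := e * cmin `^ x / 2).
  by rewrite !mulr_gt0 ?invr_gt0.
near=> z => p Pp.
have z0 : 0 < z by near: z; apply: nbhs_pinfty_gt; exact: num_real.
(* This threshold forces q = 1 / (z c(p)) <= 1 / (z cmin) < delta for all [p] at once. *)
have zdelta : (delta * cmin)^-1 < z.
  by near: z; apply: nbhs_pinfty_gt; exact: num_real.
have c0 := c_gt0 Pp.
pose q := (z * c p)^-1.
have q0 : 0 < q by rewrite invr_gt0 mulr_gt0.
have zqc : z * (q * c p) = 1 by rewrite /q; field; rewrite !gt_eqF.
have qdelta : q < delta.
  have : 1 < z * (delta * cmin).
    by move: zdelta; rewrite -[ltLHS]mul1r ltr_pdivrMr// mulr_gt0.
  rewrite /q -[(z * _)^-1]mul1r ltr_pdivrMr ?mulr_gt0// => /lt_le_trans; apply.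
  by rewrite mulrCA !ler_pM2l// cmin_le.
have qdelta0 : 0 < q < delta by rewrite q0.
have [ig b] := expansion_at mP q0 Pp zqc (Hdelta _ _ qdelta0 Pp).
split=> //; apply: le_trans b _; rewrite -(powR_scale _ q0 Pp zqc).
rewrite [leLHS](_ : _ = e * (expR (- z * f0) * z `^ (- x)) *
    (cmin `^ x * c p `^ (- x))); last by field.
(* What remains is (cmin / c(p))^x <= 1, which uses [x >= 0]. *)
rewrite ler_piMr ?mulr_ge0 ?expR_ge0 ?powR_ge0 ?(ltW e0)//.
rewrite powRN ler_pdivrMr ?powR_gt0// mul1r ge0_ler_powR ?nnegrE ?cmin_le//.
  exact: ltW.
exact: ltW.
Unshelve. all: by end_near.
Qed.

(** * Integration over P *)

Variable sigma : {measure set (borel N) -> \bar R}.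
Hypothesis sigmaP : (sigma P < +oo)%E.
Hypothesis c_meas : measurable_fun P c.
Hypothesis Lam_ge0 : forall la, la \in Lam -> 0 <= la.
Let cL la (p : borel N) := (c p `^ (- (Q + la)))%:C * L la p.

(** A measurable function bounded on a set of finite measure: [c] stays above [cmin], the exponent
    [Q + la] is nonnegative, and [le_cabs_L] bounds the other factor. *)
Lemma cintegrable_coefficient la : measurable P -> la \in Lam ->
  cintegrable sigma P (cL la).
Proof.
move=> mP laL.
apply: (@bounded_cintegrable _ _ _ _ _ _ _
  (cmin `^ (- (Q + la)) * (2 * B la))) => //.
  apply: cmeasurable_mulrl.
    exact: (measurableT_comp (measurable_powR _) c_meas).
  exact: (cmeasurable_cintegral_slice (sc_graph CP) (lebesgue_rV d)
    (cmeasurable_weighted laL mP)).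
move=> p Pp; rewrite cabsM cabs_real ger0_norm ?powR_ge0//.
apply: ler_pM => //; rewrite ?powR_ge0 ?cabs_ge0 ?le_cabs_L//.
rewrite !powRN lef_pV2 ?posrE ?powR_gt0 ?c_gt0//.
have Qla0 : 0 <= Q + la by rewrite addr_ge0 ?sumr_ge0 ?Lam_ge0.
by apply: ge0_ler_powR; rewrite ?nnegrE ?cmin_le// ltW// c_gt0.
Qed.

(** The remainder is measurable by Tonelli and bounded by [b] on a set of finite measure, hence
    integrable; adding the integrable main term gives integrability of [Iz z], and linearity leaves
    only the integral of the remainder. *)
Lemma integral_expansion_at z b : measurable P ->
  (forall p, P p -> cabs (Iz z p - main z p) <= b) ->
  cintegrable sigma P (Iz z) /\
  cabs (cintegral sigma P (Iz z) - (expR (- z * f0))%:C *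
    \sum_(la <- Lam) (z `^ (- (Q + la)))%:C * cintegral sigma P (cL la))
  <= 2 * (b * fine (sigma P)).
Proof.
move=> mP zb.
pose mn (p : borel N) := (expR (- z * f0))%:C *
  \sum_(la <- Lam) (z `^ (- (Q + la)))%:C * cL la p.
have mnE p : main z p = mn p.
  by rewrite /main /mn; congr (_ * _); apply: eq_bigr => la _; rewrite mulrA.
have iterm la : la \in Lam ->
    cintegrable sigma P (fun p => (z `^ (- (Q + la)))%:C * cL la p).
  by move=> laL; apply: cintegrableZl => //; exact: cintegrable_coefficient.
have isum : cintegrable sigma P
    (fun p => \sum_(la <- Lam) (z `^ (- (Q + la)))%:C * cL la p).
  exact: cintegrable_sum.
have imn : cintegrable sigma P mn by exact: cintegrableZl.
have mmn : cmeasurable P mn.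
  by case: imn => /integrableP[? _] /integrableP[? _]; split;
    exact/measurable_EFinP.
pose Er (p : borel N) := Iz z p + (-1)%:C * mn p.
have ErE p : Er p = Iz z p - main z p by rewrite /Er mnE rmorphN1 mulN1r.
have mEr : cmeasurable P Er.
  apply: cmeasurableD; last exact: cmeasurable_mulrl.
  exact: (cmeasurable_cintegral_slice mcut (lebesgue_rV d) (mg z)).
have Erb p : P p -> cabs (Er p) <= b by rewrite ErE; exact: zb.
have iEr : cintegrable sigma P Er by exact: bounded_cintegrable Erb.
have IE p : Er p + mn p = Iz z p by rewrite ErE mnE subrK.
split; first by apply: eq_cintegrable (cintegrableD mP iEr imn) => // p _.
rewrite -(@eq_cintegral _ _ _ _ _ (fun p => Er p + mn p)); last by move=> p _.
rewrite cintegralD//.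
have -> : cintegral sigma P mn = (expR (- z * f0))%:C *
    \sum_(la <- Lam) (z `^ (- (Q + la)))%:C * cintegral sigma P (cL la).
  rewrite cintegralZl// cintegral_sum//; congr (_ * _).
  rewrite big_seq [RHS]big_seq; apply: eq_bigr => la laL.
  by rewrite cintegralZl//; exact: cintegrable_coefficient.
rewrite addrK; apply: le_cabs_cintegral => //.
apply: (@le_trans _ _ (\int[sigma]_(x in P) b%:E)%E).
  apply: ge0_le_integral => //.
  - by move=> x _; rewrite lee_fin cabs_ge0.
  - exact/measurable_EFinP/measurable_cabs.
have -> : (\int[sigma]_(x in P) b%:E = b%:E * sigma P)%E.
  exact: integral_cst.
by rewrite EFinM fineK// ge0_fin_numE.
Qed.

Lemma integral_expansion : measurable P ->
  (\forall z \near +oo, cintegrable sigma P (Iz z)) /\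
  forall e, 0 < e -> \forall z \near +oo,
    cabs (cintegral sigma P (Iz z) - (expR (- z * f0))%:C *
      \sum_(la <- Lam) (z `^ (- (Q + la)))%:C * cintegral sigma P (cL la))
    <= e * (expR (- z * f0) * z `^ (- (Q + rho))).
Proof.
move=> mP; split.
  (* Any tolerance gives a bounded remainder, so 1 serves for integrability. *)
  apply: filterS (expansion_uniform mP ltr01) => z Hz.
  by apply: (integral_expansion_at mP (fun p Pp => (Hz p Pp).2)).1.
move=> e e0; set m := fine (sigma P).
have m0 : 0 <= m by exact: fine_ge0.
(* The pointwise tolerance will be e / (2 m + 1): integration costs a factor 2 m, and the added 1
   keeps the denominator positive when [P] has volume zero. *)
have m1 : 0 < 2 * m + 1 by rewrite ltr_wpDl// mulr_ge0.
apply: filterS (expansion_uniform mP (divr_gt0 e0 m1)) => z Hz.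
apply: le_trans (integral_expansion_at mP (fun p Pp => (Hz p Pp).2)).2 _.
rewrite -/m; set X := _ * z `^ _.
have X0 : 0 <= X by rewrite mulr_ge0 ?expR_ge0 ?powR_ge0.
rewrite [leLHS](_ : _ = e * X * (2 * m / (2 * m + 1))); last first.
  by field; rewrite gt_eqF.
apply: ler_piMr; first by rewrite mulr_ge0// ltW.
by rewrite ler_pdivrMr// mul1r lerDl.
Qed.

End expansion.

(** * From suprema and limits to pointwise bounds *)

Lemma usup_ge {R : realType} {T : Type} (D : set T) (h : T -> \bar R) x :
  D x -> (h x <= usup D h)%E.
Proof. by move=> Dx; apply: ereal_sup_ubound; right; exists x. Qed.

Theorem theorem4p3 (R : realType)
  (N : ptopologicalType) (n : nat) (X : riemannian_manifold (R := R) N n)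
  (dvol : {measure set (borel N) -> \bar R})
  (dvolP : riemannian_volume X n setT dvol)
  (f : N -> R) (f_cont : continuous f) (f_lb : has_lbound (range f))
  (a : borel N -> R[i]) (a_meas : cmeasurable setT a)
  (f0 := inf (range f)) (M := [set x | f x = f0])
  (M_nonempty : M !=set0) (M_compact : compact M)
  (l : nat) (S : 'I_l.+1 -> set N)
  (S_sub : forall j : 'I_l.+1, C2_submanifold X j (S j))
  (S_disj : trivIset setT S) (S_cover : M = \bigcup_j S j)
  (svol : 'I_l.+1 -> {measure set (borel N) -> \bar R})
  (svolP : forall j : 'I_l.+1, riemannian_volume X j (S j) (svol j))
  (eps : R) (I : finType) (K : cell_data (R := R) N n l I)
  (KP : normal_cell_decomposition X M S dvol svol eps K)
  (alpha : I) (d := codim K alpha) (d_ge1 : (1 <= d)%N)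
  (P := piece K alpha : set (borel N)) (A := cell K alpha) (F := nmap K alpha)
  (J := jac K alpha) (dvolp := svol (sdim K alpha))
  (beta : 'I_d -> R) (beta_gt0 : forall i, 0 < beta i) (Q := \sum_i beta i)
  (c : borel N -> R) (c_meas : measurable_fun P c)
  (cmin cmax : R) (cmin_gt0 : 0 < cmin)
  (c_bnd : forall p, P p -> cmin <= c p <= cmax)
  (G : N -> 'rV[R]_d -> R)
  (G_meas : measurable_fun (P `*` setT : set (borel N * borel 'rV[R]_d))
              (fun pt => G pt.1 pt.2))
  (G_ge0 : forall p t, P p -> 0 <= G p t)
  (G_hom : forall p t u, P p -> 0 < u -> G p (dilation beta u t) = u * G p t)
  (C : N -> set 'rV[R]_d) (Theta : R -> N -> 'rV[R]_d -> 'rV[R]_d)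
  (jq : R -> N -> 'rV[R]_d -> R)
  (CP : scaled_cell_representation P (scaled_cell beta A eps) C Theta jq)
  (D_ := transported_density beta Theta jq (amplitude a F J)
           (phase f f0 F c) G)
  (rho : R) (rho_gt0 : 0 < rho)
  (Lam : {fset R}) (Lam_sub : forall la, la \in Lam -> 0 <= la <= rho)
  (D : R -> N -> 'rV[R]_d -> R[i])
  (D_meas : forall la, la \in Lam ->
     cmeasurable (graph P C) (fun pt => D la pt.1 pt.2))
  (D_bnd : forall la, la \in Lam ->
     (usup P (fun p => \int[lebesgue_rV d]_(t in C p)
        (cabs (D la p t) * expR (- G p t))%:E) < +oo)%E)
  (D_exp : (fun q : R => usup P (fun p => (q `^ (- rho))%:E *
      \int[lebesgue_rV d]_(t in C p)
        (cabs (D_ q p t - \sum_(la <- Lam) (q `^ la)%:C * D la p t)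
          * expR (- G p t))%:E)%E) @ 0^'+ --> 0%E)
  (L := fun la p => cintegral (lebesgue_rV d) (C p : set (borel 'rV[R]_d))
     (fun t => D la p t * (expR (- G p t))%:C))
  (Iz := cell_integral f a F J A eps) :
  [/\ \forall z \near +oo, forall p, P p ->
        cintegrable (lebesgue_rV d)
          (cut_cell A eps p : set (borel 'rV[R]_d)) (cell_integrand f a F J z p),
      forall e, 0 < e -> \forall z \near +oo, forall p, P p ->
        cabs (Iz z p - (expR (- z * f0))%:C *
               \sum_(la <- Lam) (z `^ (- (Q + la)))%:C *
                 (c p `^ (- (Q + la)))%:C * L la p)
          <= e * (expR (- z * f0) * z `^ (- (Q + rho))) &
      (dvolp P < +oo)%E ->
      [/\ \forall z \near +oo, cintegrable dvolp P (Iz z),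
          forall la, la \in Lam -> cintegrable dvolp P
            (fun p => (c p `^ (- (Q + la)))%:C * L la p) &
          forall e, 0 < e -> \forall z \near +oo,
            cabs (cintegral dvolp P (Iz z) - (expR (- z * f0))%:C *
                   \sum_(la <- Lam) (z `^ (- (Q + la)))%:C *
                     cintegral dvolp P
                       (fun p => (c p `^ (- (Q + la)))%:C * L la p))
              <= e * (expR (- z * f0) * z `^ (- (Q + rho)))]].
Proof.
have mP : measurable P by exact: nc_piece_Borel KP alpha.
have mA : measurable (graph P A) by exact: nc_cell_graph KP alpha.
have mcut := measurable_cut_cell_graph eps mA.
have [PU _] := nc_nbhd KP alpha.
(* Continuity of [F] is available only within the neighbourhood of the piece times the ball, which
   contains this graph. *)
have mF : measurable_fun (graph P (cut_cell A eps))
    (fun ps => F ps.1 ps.2 : borel N).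
  have [cF _] := nc_nmap_C1 KP alpha.
  apply: (measurable_within_continuous (rm_second_countable X) cF).
  by move=> [p s] [/PU ? [_ ?]].
have mJ : measurable_fun (graph P (cut_cell A eps)) (fun ps => J ps.1 ps.2).
  exact: (nc_jac_meas KP).
have mg z := cmeasurable_cell_integrand z f_cont a_meas mF mJ.
have c_gt0 p : P p -> 0 < c p.
  by move=> /c_bnd /andP[+ _]; exact: lt_le_trans.
have cmin_le p : P p -> cmin <= c p by move=> /c_bnd /andP[].
have beta_ge0 i : 0 <= beta i by exact: ltW.
have Lam_ge0 la : la \in Lam -> 0 <= la by move=> /Lam_sub /andP[].
pose u la := usup P (fun p => \int[lebesgue_rV d]_(t in C p)
  (cabs (D la p t) * expR (- G p t))%:E)%E.
have D_bnd' la p : la \in Lam -> P p -> (\int[lebesgue_rV d]_(t in C p)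
    (cabs (D la p t) * expR (- G p t))%:E <= (fine (u la))%:E)%E.
  (* The supremum is finite: it is below +oo by [D_bnd], and nonnegative because [usup] adjoins
     0. *)
  move=> laL Pp; rewrite fineK; first exact: usup_ge.
  rewrite ge0_fin_numE; first exact: D_bnd.
  by apply: ereal_sup_ubound; left.
have D_exp' e : 0 < e -> exists2 delta, 0 < delta &
    forall q p, 0 < q < delta -> P p ->
    ((q `^ (- rho))%:E * \int[lebesgue_rV d]_(t in C p)
       (cabs (D_ q p t - \sum_(la <- Lam) (q `^ la)%:C * D la p t)
          * expR (- G p t))%:E <= e%:E)%E.
  move=> e0.
  (* The limit is tested on the open ray below [e]; the right neighbourhood of 0 supplies [delta],
     and the supremum dominates each [p]. *)
  have /D_exp [delta /= delta0 H] : nbhs 0%E [set y : \bar R | (y < e%:E)%E].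
    apply: open_nbhs_nbhs; split; first exact: open_ereal_lt_ereal.
    by rewrite /= lte_fin.
  exists delta => // q p /andP[q0 qdelta] Pp.
  apply: le_trans (ltW (H q _ q0)); first exact: usup_ge.
  by rewrite /= sub0r normrN gtr0_norm.
have unif e (e0 : 0 < e) := expansion_uniform CP c_gt0 mcut mg G_meas D_meas
  D_bnd' cmin_gt0 cmin_le beta_ge0 (ltW rho_gt0) D_exp' mP e0.
split=> [|e e0|Pfin].
- by apply: filterS (unif _ ltr01) => z Hz p /Hz[].
- by apply: filterS (unif _ e0) => z Hz p /Hz[].
have [near_int near_exp] := integral_expansion CP c_gt0 mcut mg G_meas D_meas
  D_bnd' cmin_gt0 cmin_le beta_ge0 (ltW rho_gt0) D_exp' Pfin c_meas Lam_ge0 mP.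
split=> // la laL.
exact: (cintegrable_coefficient CP c_gt0 G_meas D_meas D_bnd' cmin_gt0
  cmin_le beta_ge0 Pfin c_meas Lam_ge0 mP laL).
Qed.
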